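(* Let $P$ be a probability distribution on $\mathcal{X}=\mathbb{F}_d^2$, $\mathcal{A}\sim\{\sqrt{P(u)}N_u\}_{u\in\mathcal{X}}$, let $1\le k\le n$, let $L\subset\mathbb{F}^{2n}$ be a self-orthogonal subspace with $\dim L=n-k$, and let $P_L$ be the associated distribution on $\mathbb{F}^{n-k}\times\mathbb{F}^{2k}$. Define $$E_{n,k}(R,P_L)=\min_{P'}\big[D(P'\|P_L)+|k-kR-H(\overleftarrow{P'}\,|\,\bar{P'})|^+\big],$$ where $|x|^+=\max\{x,0\}$ and the minimum is over all probability distributions $P'$ on $\mathbb{F}^{n-k}\times\mathbb{F}^{2k}$. Then for every $R'$ with $0\le R'\le1$, $$\limsup_{M\to\infty}\ -\frac{\log_d\big[1-F^\star_{M,R'M}(\mathcal{A}^{\otimes M})\big]}{M}\ \ge\ \frac{E_{n,k}(R'n/k,\,P_L)}{n}.$$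
   Context: Let $d$ be a prime, $\mathbb{F}=\mathbb{F}_d$, $\mathcal{H}$ a $d$-dimensional Hilbert space with orthonormal basis $\{|0\rangle,\dots,|d-1\rangle\}$, $\omega$ a primitive $d$-th root of unity, $X|j\rangle=|(j-1)\bmod d\rangle$, $Z|j\rangle=\omega^j|j\rangle$, $\mathcal{X}=\mathbb{F}^2$, $N_{(i,j)}=X^iZ^j$. For $x=((u_1,v_1),\dots,(u_n,v_n))\in\mathcal{X}^n$, identified with $(u_1,v_1,\dots,u_n,v_n)\in\mathbb{F}^{2n}$, $N_x=N_{(u_1,v_1)}\otimes\cdots\otimes N_{(u_n,v_n)}$. The symplectic form on $\mathbb{F}^{2n}$ is $\langle x,y\rangle=\sum_i(u_iv_i'-v_iu_i')$; $L^\perp=\{y:\langle x,y\rangle=0\ \forall x\in L\}$; $L$ is self-orthogonal if $L\subset L^\perp$. The channel $\mathcal{A}\sim\{\sqrt{P(u)}N_u\}$ maps $\rho\mapsto\sum_uP(u)N_u\rho N_u^\dagger$, and $\mathcal{A}^{\otimes M}(\rho)=\sum_{x\in\mathcal{X}^M}P^M(x)N_x\rho N_x^\dagger$, $P^M(x)=\prod_iP(x_i)$. Codes and fidelity: a code is $(\mathcal{C},\mathcal{R})$ with $\mathcal{C}\subset\mathcal{H}^{\otimes M}$ a subspace and $\mathcal{R}$ a trace-preserving completely positive map; $F(\mathcal{C},\mathcal{R}\mathcal{A}^{\otimes M})=\min_{\text{unit }\psi\in\mathcal{C}}\langle\psi|\mathcal{R}(\mathcal{A}^{\otimes M}(|\psi\rangle\langle\psi|))|\psi\rangle$;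 for integer $M\ge1$ and real $0\le K\le M$, $F^\star_{M,K}(\mathcal{A}^{\otimes M})$ is the supremum of this over codes with $\log_d\dim\mathcal{C}\ge K$. Definition of $P_L$: with $\dim L=n-k$ and a basis $g_1,\dots,g_{n-k}$ of $L$, choose (such exist) $g_{n-k+1},\dots,g_n,h_1,\dots,h_n\in\mathbb{F}^{2n}$ with $\langle g_i,h_j\rangle=\delta_{ij}$, $\langle g_i,g_j\rangle=\langle h_i,h_j\rangle=0$, and fix such a choice. For $x=\sum_i(w_ig_i+z_ih_i)$ put $\varphi_{2i-1}(x)=w_i$, $\varphi_{2i}(x)=z_i$. Then $P_L(s,(u_1,u_1',\dots,u_k,u_k'))=\sum P^n(x)$, summed over $x\in\mathbb{F}^{2n}$ with $\varphi_{2i}(x)=s_i$ for $1\le i\le n-k$ and $\varphi_{2i-1}(x)=u_{i-n+k}$, $\varphi_{2i}(x)=u'_{i-n+k}$ for $n-k<i\le n$, where $s=(s_1,\dots,s_{n-k})$. Entropic notation (all logarithms base $d$): for $Q$ on $\mathcal{Y}\times\mathcal{Z}$, $\bar Q(u)=\sum_vQ(u,v)$ and $\overleftarrow{Q}(v|u)=Q(u,v)/\bar Q(u)$ when $\bar Q(u)>0$ (undefined otherwise); for a stochastic matrix $W$ and distribution $p$, $H(W|p)=-\sum_{u:p(u)>0}\sum_vp(u)W(v|u)\log_dW(v|u)$; $D(P\|Q)=\sum_uP(u)\log_d[P(u)/Q(u)]$; conventions $0\log0=0\log(0/0)=0$, $\log(a/0)=\infty$ for $a>0$. *)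

(* Defs.v *)
From HB Require Import structures.
From mathcomp Require Import all_boot all_order all_algebra.
From mathcomp Require Import boolp classical_sets reals ereal exp sequences.
From mathcomp Require Import complex.
Unset Printing Implicit Defensive.
Import Order.TTheory GRing.Theory Num.Theory.
Local Open Scope ring_scope.

Definition Cr {R : realType} (x : R) : R[i] := Complex x 0.

Definition adj {R : realType} {m n : nat} (A : 'M[R[i]]_(m, n)) : 'M[R[i]]_(n, m) :=
  (map_mx conjc A)^T.

Definition logd {R : realType} (d : nat) (x : R) : R := ln x / ln (d%:R).

(* log base d with the convention log 0 = -oo (argument assumed >= 0) *)
Definition elogd {R : realType} (d : nat) (x : R) : \bar R :=
  if x == 0 then -oo%E else (logd d x)%:E.

Definition posp {R : realType} (x : R) : R := Num.max x 0.

Definition isDist {R : realType} {T : finType} (p : T -> R) : Prop :=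
  (forall t, 0 <= p t) /\ \sum_t p t = 1.

Definition marg {R : realType} {Y Z : finType} (Q : Y * Z -> R) (u : Y) : R :=
  \sum_v Q (u, v).

(* overleftarrow Q (v | u) = Q(u,v) / \bar Q(u)  (only used when \bar Q u > 0) *)
Definition condW {R : realType} {Y Z : finType} (Q : Y * Z -> R) (u : Y) (v : Z) : R :=
  Q (u, v) / marg Q u.

(* H(W|p) = - sum_{u : p u > 0} sum_v p(u) W(v|u) log_d W(v|u)   (0 log 0 = 0) *)
Definition Hcond {R : realType} {Y Z : finType} (d : nat)
    (W : Y -> Z -> R) (p : Y -> R) : R :=
  - \sum_(u | 0 < p u) \sum_(v | 0 < W u v) p u * W u v * logd d (W u v).

(* D(P||Q) = sum_u P(u) log_d (P(u)/Q(u)), with 0 log(0/q) = 0 and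
   log(a/0) = +oo for a > 0 *)
Definition KLdiv {R : realType} {T : finType} (d : nat) (P Q : T -> R) : \bar R :=
  if [exists u, (0 < P u) && (Q u == 0)] then +oo%E
  else (\sum_(u | 0 < P u) P u * logd d (P u / Q u))%:E.

(* E_{n,k}(Rt, Q) = min_{P'} [ D(P'||Q) + |k - k Rt - H(<-P' | \bar P')|^+ ]
   (written as an infimum; the minimum is attained) *)
Definition Enk {R : realType} {Y Z : finType} (d k : nat) (Rt : R)
    (Q : Y * Z -> R) : \bar R :=
  ereal_inf [set e : \bar R | exists P' : Y * Z -> R, isDist P' /\
     e = (KLdiv d P' Q + (posp (k%:R - k%:R * Rt - Hcond d (condW P') (marg P')))%:E)%E].

(* X|j> = |(j-1) mod d> ;  entry (m,l) = <m|X|l> *)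
Definition shiftX {R : realType} (d : nat) : 'M[R[i]]_d :=
  \matrix_(m, l) ((((m : nat) == ((l : nat) + d.-1) %% d)%N)%:R).

Definition phaseZ {R : realType} (d : nat) (omega : R[i]) : 'M[R[i]]_d :=
  \matrix_(m, l) (if m == l then omega ^+ (l : nat) else 0).

Definition Npauli {R : realType} (d : nat) (omega : R[i]) (u : 'F_d * 'F_d) : 'M[R[i]]_d :=
  (@shiftX R d) ^+ (val u.1) * (phaseZ d omega) ^+ (val u.2).

(* computational basis of H^{(x)M}: tuples j_1 ... j_M *)
Definition QBasis (d M : nat) : finType := {ffun 'I_M -> 'I_d}.

(* N_x = N_{x_1} (x) ... (x) N_{x_M}, as a matrix indexed by QBasis d M *)
Definition Ntens {R : realType} (d : nat) (omega : R[i]) (M : nat)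
    (x : {ffun 'I_M -> 'F_d * 'F_d}) : 'M[R[i]]_#|QBasis d M| :=
  \matrix_(a, b) \prod_(i < M)
     Npauli d omega (x i) (@enum_val (QBasis d M) predT a i) (@enum_val (QBasis d M) predT b i).

Definition Ppow {R : realType} (d M : nat) (P : 'F_d * 'F_d -> R)
    (x : {ffun 'I_M -> 'F_d * 'F_d}) : R := \prod_(i < M) P (x i).

Definition chanM {R : realType} (d : nat) (omega : R[i]) (P : 'F_d * 'F_d -> R) (M : nat)
    (rho : 'M[R[i]]_#|QBasis d M|) : 'M[R[i]]_#|QBasis d M| :=
  \sum_(x : {ffun 'I_M -> 'F_d * 'F_d})
     Cr (Ppow d M P x) *: (Ntens d omega M x *m rho *m adj (Ntens d omega M x)).

Definition Kraus_TP {R : realType} {N m : nat} (Ks : 'I_m -> 'M[R[i]]_N) : Prop :=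
  \sum_(j < m) adj (Ks j) *m Ks j = 1%:M.

Definition Kraus_map {R : realType} {N m : nat} (Ks : 'I_m -> 'M[R[i]]_N)
    (rho : 'M[R[i]]_N) : 'M[R[i]]_N :=
  \sum_(j < m) Ks j *m rho *m adj (Ks j).

(* F(C, Phi) = min_{unit psi in C} <psi| Phi(|psi><psi|) |psi>;
   the code C is the row space of Cm, kets are psi^T for row vectors psi *)
Definition fidelity {R : realType} {N : nat} (Cm : 'M[R[i]]_N)
    (Phi : 'M[R[i]]_N -> 'M[R[i]]_N) : R :=
  inf [set f : R | exists psi : 'rV[R[i]]_N,
        [/\ (psi <= Cm)%MS, (map_mx conjc psi *m psi^T) 0 0 = 1 &
            f = complex.Re ((map_mx conjc psi *m Phi (psi^T *m map_mx conjc psi) *m psi^T) 0 0)]].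

Definition Fstar {R : realType} (d : nat) (omega : R[i]) (P : 'F_d * 'F_d -> R)
    (M : nat) (K : R) : R :=
  sup [set f : R | exists (Cm : 'M[R[i]]_#|QBasis d M|) (m : nat)
                          (Ks : 'I_m -> 'M[R[i]]_#|QBasis d M|),
        [/\ Kraus_TP Ks,
            (0 < \rank Cm)%N /\ K <= logd d (\rank Cm)%:R &
            f = fidelity Cm (fun rho => Kraus_map Ks (chanM d omega P M rho))]].

Definition errexp {R : realType} (d : nat) (omega : R[i]) (P : 'F_d * 'F_d -> R)
    (Rp : R) (M : nat) : \bar R :=
  (- elogd d (1 - Fstar d omega P M (Rp * M%:R)) * (M%:R^-1)%:E)%E.

(* x in F^{2n} is a row vector (u_1,v_1,...,u_n,v_n) : 'rV_(n*2);
   vec_mx x : 'M_(n,2) has rows (u_i, v_i) *)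
Definition ucoord {F : fieldType} {n : nat} (x : 'rV[F]_(n * 2)) (i : 'I_n) : F :=
  vec_mx x i ord0.
Definition vcoord {F : fieldType} {n : nat} (x : 'rV[F]_(n * 2)) (i : 'I_n) : F :=
  vec_mx x i ord_max.

Definition sympl {F : fieldType} {n : nat} (x y : 'rV[F]_(n * 2)) : F :=
  \sum_(i < n) (ucoord x i * vcoord y i - vcoord x i * ucoord y i).

Definition in_sperp {F : fieldType} {n : nat} (Lm : 'M[F]_(n * 2)) (y : 'rV[F]_(n * 2)) : Prop :=
  forall x : 'rV[F]_(n * 2), (x <= Lm)%MS -> sympl x y = 0.

Definition self_orthogonal {F : fieldType} {n : nat} (Lm : 'M[F]_(n * 2)) : Prop :=
  forall y : 'rV[F]_(n * 2), (y <= Lm)%MS -> in_sperp Lm y.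

Definition Pvec {R : realType} (d n : nat) (P : 'F_d * 'F_d -> R) (x : 'rV['F_d]_(n * 2)) : R :=
  \prod_(i < n) P (ucoord x i, vcoord x i).

(* P_L(s, (u_1,u_1',...,u_k,u_k')) : sum of P^n(x) over x = sum_i (w_i g_i + z_i h_i)
   with z_i = s_i (i <= n-k) and w_i = u_{i-n+k}, z_i = u'_{i-n+k} (i > n-k).
   (0-based indices.) *)
Definition PL {R : realType} (d n k : nat) (P : 'F_d * 'F_d -> R)
    (g h : 'I_n -> 'rV['F_d]_(n * 2))
    (su : 'rV['F_d]_(n - k) * 'rV['F_d]_(k * 2)) : R :=
  \sum_(x : 'rV['F_d]_(n * 2) |
        [exists w : {ffun 'I_n -> 'F_d}, exists z : {ffun 'I_n -> 'F_d},
          [&& x == \sum_(i < n) (w i *: g i + z i *: h i),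
              [forall i : 'I_n, forall j : 'I_(n - k),
                 (val i == val j) ==> (z i == su.1 0 j)] &
              [forall i : 'I_n, forall j : 'I_k,
                 (val i == n - k + val j)%N ==>
                   ((w i == ucoord su.2 j) && (z i == vcoord su.2 j))]]])
     Pvec d n P x.

Definition firstg {F : fieldType} {n k : nat} (g : 'I_n -> 'rV[F]_(n * 2)) : 'M[F]_(n - k, n * 2) :=
  \matrix_(i < n - k) g (widen_ord (leq_subr k n) i).

(* Main.v *)
Require Import Defs.
From HB Require Import structures.
From mathcomp Require Import all_boot all_order all_algebra.
From mathcomp Require Import boolp classical_sets reals ereal exp sequences.
From mathcomp Require Import complex spectral topology normedtype realfun.
From mathcomp Require Import ring lra zify.
Import Order.TTheory GRing.Theory Num.Theory numFieldNormedType.Exports.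
Local Open Scope ring_scope.

(** Concatenate [N] copies of the stabilizer code of [L] with a random outer
    stabilizer code.  In the symplectic coordinates attached to [g] and [h] an
    error on [N] blocks is a triple [(w, s, u)]: [w] lies in [L^N] and is harmless,
    [s] is the inner syndrome, and [u] is the effective error on which the outer code,
    given by an isotropic [T], acts.  The pair [(s, u)] has law [P_L^N].  The image of
    [T] under a random isometry contains a given nonzero vector in its orthogonal with
    probability at most [1 / #|T|], so maximum likelihood decoding fails with average
    probability at most [#|T|^(-rho) * (\sum_s (\sum_u P_L(s,u)^(1/(1+rho)))^(1+rho))^N]
    for every [rho] in [[0, 1]] (Gallager's bound).  Tilting [P_L] and choosing [rho]
    by the intermediate value theorem shows that the best exponent obtained in this way
    is at least [E_{n,k}]; as only a limsup is bounded, lengths divisible by [n] suffice. *)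

(** * Adjoints and fidelity bounds *)

(** One code and one distribution suffice: [Fstar] is a supremum, so an existence proof by averaging
    is enough, and [Enk] is an infimum, so its value at a single tilted distribution bounds it from
    above. Two obstacles shape the argument. The fidelity is a minimum over all code states, whereas
    averaging controls a probability. For a stabilizer code the success probability bounds the
    fidelity from below: if the error and the decoder's guess differ by an element of the
    stabilizer, the code space is restored up to a scalar of modulus one, so one estimate serves
    every [psi] at once. Secondly, errors that differ by an element of [L^N] act alike on the code,
    so the decoder compares the summed probabilities and not those of individual errors; the inner
    syndrome [s] becomes side information, which is why a conditional entropy appears. The bound
    [rho <= 1] in Gallager's method corresponds to the slope 1 of the positive part. Phases of the
    stabilizer are read off a common eigenvector, because for [d = 2] they need not be powers of
    [omega]. *)

Section Adjoint.
Context {R : realType}.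
Implicit Types m n p q : nat.
Local Notation C := R[i].

Lemma adjM m n p (A : 'M[C]_(m, n)) (B : 'M[C]_(n, p)) :
  adj (A *m B) = adj B *m adj A.
Proof. by rewrite /adj map_mxM trmx_mul. Qed.

Lemma conjmx_adj m n (A : 'M[C]_(m, n)) : map_mx conjc A = adj A^T.
Proof. by rewrite /adj map_trmx trmxK. Qed.

Lemma adjK m n (A : 'M[C]_(m, n)) : adj (adj A) = A.
Proof. by apply/matrixP=> i j; rewrite !mxE conjcK. Qed.

Lemma adjE m n (A : 'M[C]_(m, n)) i j : adj A i j = conjc (A j i).
Proof. by rewrite !mxE. Qed.

Lemma adj1 n : adj (1%:M : 'M[C]_n) = 1%:M.
Proof. by rewrite /adj map_mx1 trmx1. Qed.

Lemma adjD m n (A B : 'M[C]_(m, n)) : adj (A + B) = adj A + adj B.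
Proof. by rewrite /adj map_mxD linearD. Qed.

Lemma adjZ m n a (A : 'M[C]_(m, n)) : adj (a *: A) = conjc a *: adj A.
Proof. by rewrite /adj map_mxZ linearZ. Qed.

Lemma adj_sum m n (I : Type) (r : seq I) (Q : pred I) (F : I -> 'M[C]_(m, n)) :
  adj (\sum_(i <- r | Q i) F i) = \sum_(i <- r | Q i) adj (F i).
Proof. by rewrite /adj map_mx_sum linear_sum. Qed.

Lemma conjcCr (x : R) : conjc (Cr x) = Cr x.
Proof. by rewrite /Cr /= oppr0. Qed.

Lemma Re_sum (I : Type) (r : seq I) (Q : pred I) (F : I -> C) :
  complex.Re (\sum_(i <- r | Q i) F i) = \sum_(i <- r | Q i) complex.Re (F i).
Proof.
by apply: (big_morph (fun z : C => complex.Re z)) => // -[? ?] [? ?].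
Qed.

Lemma Re_CrM (x : R) (z : C) : complex.Re (Cr x * z) = x * complex.Re z.
Proof. by case: z => a b; rewrite /Cr /= mul0r subr0. Qed.

Definition normsq (z : C) : R := complex.Re (conjc z * z).

Lemma normsq_ge0 z : 0 <= normsq z.
Proof. by case: z => a b; rewrite /normsq /= mulNr opprK -!expr2 addr_ge0 ?sqr_ge0. Qed.

Lemma normsq_Re z : conjc z * z = Cr (normsq z).
Proof.
by case: z => a b; rewrite /normsq /Cr /=; congr Complex; ring.
Qed.

Lemma normsqM z w : normsq (z * w) = normsq z * normsq w.
Proof. by case: z w => a b [c e]; rewrite /normsq /=; ring. Qed.

Definition colnorm {n} (v : 'cV[C]_n) : R := complex.Re ((adj v *m v) 0 0).

Lemma colnormE n (v : 'cV[C]_n) : colnorm v = \sum_i normsq (v i 0).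
Proof.
by rewrite /colnorm mxE Re_sum; apply: eq_bigr => i _; rewrite !mxE.
Qed.

Lemma colnorm_ge0 n (v : 'cV[C]_n) : 0 <= colnorm v.
Proof. by rewrite colnormE sumr_ge0 // => i _; exact: normsq_ge0. Qed.

Lemma colnorm_gt0 n (v : 'cV[C]_n) : v != 0 -> 0 < colnorm v.
Proof.
move=> v0; rewrite lt_neqAle colnorm_ge0 andbT eq_sym; apply: contra v0.
rewrite colnormE psumr_eq0 => [/allP H|i _]; last exact: normsq_ge0.
apply/eqP/colP => i; move: (H i (mem_index_enum _)); rewrite /= !mxE.
case: (v i 0) => a b; rewrite /normsq /= mulNr opprK -!expr2.
by rewrite paddr_eq0 ?sqr_ge0 // !sqrf_eq0 => /andP[/eqP -> /eqP ->].
Qed.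

Lemma adj_mul_col n (v : 'cV[C]_n) : (adj v *m v) 0 0 = Cr (colnorm v).
Proof.
rewrite mxE colnormE /Cr.
transitivity (\sum_i Cr (normsq (v i 0))).
  by apply: eq_bigr => i _; rewrite !mxE normsq_Re.
elim/big_rec2: _ => //= i x y _ ->.
by rewrite /Cr; congr Complex; rewrite addr0.
Qed.

(** Bessel's inequality: the difference of the two sides is the squared norm of the component of [v]
    orthogonal to the unit vector [f]. *)
Lemma colnorm_proj n (f v : 'cV[C]_n) : adj f *m f = 1%:M ->
  normsq ((adj f *m v) 0 0) <= colnorm v.
Proof.
move=> f1; rewrite -subr_ge0.
suff -> : colnorm v - normsq ((adj f *m v) 0 0) =
          colnorm (v - f *m (adj f *m v)) by exact: colnorm_ge0.
set w := adj f *m v.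
have vf : adj v *m f = adj w by rewrite /w adjM adjK.
have adjN m (A : 'cV[C]_m) : adj (- A) = - adj A by rewrite -scaleN1r adjZ rmorphN rmorph1 scaleN1r.
rewrite [RHS]/colnorm.
have -> : adj (v - f *m w) *m (v - f *m w) = adj v *m v - adj w *m w.
  rewrite adjD adjN adjM mulmxDr !mulmxDl !mulmxN !mulNmx.
  rewrite (mulmxA (adj v)) vf -(mulmxA (adj w) (adj f) v) -/w.
  by rewrite -(mulmxA (adj w)) (mulmxA (adj f)) f1 mul1mx opprK addNr addr0.
have -> : normsq (w 0 0) = complex.Re ((adj w *m w) 0 0).
  by rewrite [in RHS]mxE big_ord1 !mxE.
rewrite /colnorm [in RHS]mxE [X in _ = complex.Re (_ + X)]mxE.
by case: ((adj v *m v) 0 0) => ? ?; case: ((adj w *m w) 0 0).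
Qed.

End Adjoint.

Section FidelityBounds.
Context {R : realType}.
Local Notation C := R[i].

(** An error [E x] followed by a Kraus operator [Ks j] sends a ket to a ket, so the fidelity is a
    weighted sum of squared overlaps and can be estimated error by error. *)
Lemma fidelity_valueE (D m : nat) (X : finType) (p : X -> R) (E : X -> 'M[C]_D)
    (Ks : 'I_m -> 'M[C]_D) (psi : 'rV[C]_D) :
  complex.Re ((map_mx conjc psi *m
     Kraus_map Ks (\sum_x Cr (p x) *: (E x *m (psi^T *m map_mx conjc psi) *m adj (E x)))
     *m psi^T) 0 0) =
  \sum_x p x * \sum_j normsq ((adj psi^T *m (Ks j *m (E x *m psi^T))) 0 0).
Proof.
rewrite conjmx_adj; set f := psi^T; rewrite /Kraus_map.
rewrite mulmx_sumr mulmx_suml summxE Re_sum.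
transitivity (\sum_j \sum_x p x * normsq ((adj f *m (Ks j *m (E x *m f))) 0 0)); last first.
  by rewrite exchange_big; apply: eq_bigr => x _; rewrite big_distrr.
apply: eq_bigr => j _.
rewrite mulmx_sumr mulmx_suml mulmx_sumr mulmx_suml summxE Re_sum.
apply: eq_bigr => x _.
rewrite -scalemxAr -!scalemxAl -scalemxAr -scalemxAl mxE Re_CrM; congr (_ * _).
set w := adj f *m (Ks j *m (E x *m f)).
have -> : adj f *m (Ks j *m (E x *m (f *m adj f) *m adj (E x)) *m adj (Ks j)) *m f
        = w *m adj w.
  by rewrite /w !adjM adjK !mulmxA.
by rewrite mxE big_ord1 !mxE /normsq mulrC.
Qed.

(** Bessel bounds each overlap by a squared norm; trace preservation and unitarity of the errors
    make these norms sum to 1. This keeps the supremum in [Fstar] bounded. *)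
Lemma fidelity_value_le1 (D m : nat) (X : finType) (p : X -> R) (E : X -> 'M[C]_D)
    (Ks : 'I_m -> 'M[C]_D) (psi : 'rV[C]_D) :
  isDist p -> (forall x, adj (E x) *m E x = 1%:M) -> Kraus_TP Ks ->
  (map_mx conjc psi *m psi^T) 0 0 = 1 ->
  \sum_x p x * \sum_j normsq ((adj psi^T *m (Ks j *m (E x *m psi^T))) 0 0) <= 1.
Proof.
move=> [p0 p1] uE TP psi1; rewrite -p1; apply: ler_sum => x _.
rewrite -[leRHS]mulr1; apply: ler_wpM2l => //.
have f1 : adj psi^T *m psi^T = 1%:M.
  by rewrite [LHS]mx11_scalar -conjmx_adj psi1.
apply: (@le_trans _ _ (\sum_j colnorm (Ks j *m (E x *m psi^T)))).
  by apply: ler_sum => j _; exact: colnorm_proj.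
rewrite /colnorm -Re_sum -summxE.
have -> : \sum_j adj (Ks j *m (E x *m psi^T)) *m (Ks j *m (E x *m psi^T)) = 1%:M.
  under eq_bigr => j _ do rewrite adjM -mulmxA (mulmxA (adj (Ks j))).
  rewrite -mulmx_sumr -mulmx_suml (TP : _ = _) mul1mx adjM -mulmxA.
  by rewrite (mulmxA (adj (E x))) uE mul1mx.
by rewrite mxE.
Qed.

Lemma unit_vector_in (D : nat) (A : 'M[C]_D) : (0 < \rank A)%N ->
  exists2 psi : 'rV[C]_D, (psi <= A)%MS & (map_mx conjc psi *m psi^T) 0 0 = 1.
Proof.
rewrite lt0n mxrank_eq0 => /rowV0Pn [v vA v0].
have nE : (map_mx conjc v *m v^T) 0 0 = Cr (colnorm v^T).
  by rewrite -adj_mul_col -conjmx_adj.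
have n0 : 0 < colnorm v^T by apply: colnorm_gt0; rewrite trmx_eq0.
pose c : C := Cr (Num.sqrt (colnorm v^T))^-1.
exists (c *: v); first exact: scalemx_sub.
rewrite map_mxZ linearZ /= -scalemxAl -scalemxAr scalerA mxE nE.
rewrite /= oppr0 /c /Cr; set s := Num.sqrt _.
have ss : colnorm v^T = s * s by rewrite -expr2 sqr_sqrtr // ltW.
have s0 : s != 0 by rewrite sqrtr_eq0 -ltNge.
rewrite ss; apply/eqP; rewrite eq_complex /=; apply/andP; split; apply/eqP; by field.
Qed.

End FidelityBounds.

(** * Stabilizer codes of a projective representation *)

Section Pairing.
Context {C : numFieldType} {F : zmodType} {V : finZmodType}.
Variables (e : F -> C) (B : V -> V -> F).
Hypotheses (e0 : e 0 = 1) (eD : forall a b, e (a + b) = e a * e b).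
Hypothesis e_inj : forall a, a != 0 -> e a != 1.
Hypotheses (BDl : forall x y z, B (x + y) z = B x z + B y z).
Hypotheses (BDr : forall x y z, B z (x + y) = B z x + B z y).
Hypothesis B_nondeg : forall x, x != 0 -> exists y, B y x != 0.

Lemma form_x0 x : B x 0 = 0.
Proof. by apply: (@addrI _ (B x 0)); rewrite -BDr !addr0. Qed.

Lemma form_0x x : B 0 x = 0.
Proof. by apply: (@addrI _ (B 0 x)); rewrite -BDl !addr0. Qed.

Lemma formNl x y : B (- x) y = - B x y.
Proof. by apply: (@addrI _ (B x y)); rewrite -BDl !subrr form_0x. Qed.

(** For [x != 0], translating the summation variable by some [y0] with [B y0 x != 0] multiplies the
    sum by a factor different from 1, so the sum vanishes. *)
Lemma sum_character x : \sum_y e (B y x) = if x == 0 then #|V|%:R else 0.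
Proof.
case: eqP => [->|/eqP x0].
  under eq_bigr do rewrite form_x0 e0.
  by rewrite sumr_const.
have [y0 By0] := B_nondeg x x0.
have : (e (B y0 x) - 1) * \sum_y e (B y x) = 0.
  rewrite mulrBl mul1r; apply/eqP; rewrite subr_eq0; apply/eqP.
  rewrite big_distrr /= [RHS](reindex_inj (addrI y0)) /=.
  by apply: eq_bigr => y _; rewrite BDl eD.
by move/eqP; rewrite mulf_eq0 subr_eq0 (negPf (e_inj _ By0)) => /eqP.
Qed.

Variable S : pred V.
Hypotheses (S0 : 0 \in S) (SB : forall x y, x \in S -> y \in S -> x - y \in S).

Lemma subgroupN x : x \in S -> - x \in S.
Proof. by move=> xS; rewrite -sub0r SB. Qed.

Lemma subgroupDr x y : y \in S -> (x + y \in S) = (x \in S).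
Proof.
move=> yS; apply/idP/idP => [xyS|xS]; first by rewrite -(addrK y x) SB.
by rewrite -[y]opprK SB // subgroupN.
Qed.

Definition perp : pred V := [pred y | [forall z in S, B y z == 0]].

Lemma perpP y : reflect (forall z, z \in S -> B y z = 0) (y \in perp).
Proof.
by apply: (iffP forall_inP) => H z zS; [apply/eqP|apply/eqP]; exact: H.
Qed.

Lemma perpB x y : x \in perp -> y \in perp -> x - y \in perp.
Proof.
move=> /perpP Hx /perpP Hy; apply/perpP => z zS.
by rewrite BDl formNl Hx // Hy // subr0.
Qed.

Lemma perp0 : 0 \in perp.
Proof. by apply/perpP => z _; exact: form_0x. Qed.

Lemma sum_character_subgroup y :
  \sum_(z in S) e (B y z) = if y \in perp then #|S|%:R else 0.
Proof.
case: (boolP (y \in perp)) => [/perpP yS|].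
  under eq_bigr => z zS do rewrite yS // e0.
  by rewrite sumr_const.
rewrite negb_forall => /existsP [z0]; rewrite negb_imply => /andP[z0S Bz0].
have : (e (B y z0) - 1) * \sum_(z in S) e (B y z) = 0.
  rewrite mulrBl mul1r; apply/eqP; rewrite subr_eq0; apply/eqP.
  rewrite big_distrr /= [RHS](reindex_inj (addIr z0)) /=.
  apply: eq_big => [z|z zS]; first by rewrite subgroupDr.
  by rewrite BDr eD mulrC.
by move/eqP; rewrite mulf_eq0 subr_eq0 (negPf (e_inj _ Bz0)) => /eqP.
Qed.

(** Double counting of [e (B y z)] over all [y] and all [z \in S]: summing over [y] first leaves
    only [z = 0]; summing over [z] first leaves the annihilator, each member with weight [#|S|]. *)
Lemma card_perp : (#|S| * #|perp|)%N = #|V|.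
Proof.
apply/eqP; rewrite -(eqr_nat C) natrM.
have <- : \sum_y \sum_(z in S) e (B y z) = #|V|%:R.
  rewrite exchange_big /= (bigD1 0) //= sum_character eqxx big1 ?addr0 // => z /andP[_ z0].
  by rewrite sum_character (negPf z0).
under eq_bigr => y _ do rewrite sum_character_subgroup.
by rewrite -big_mkcond /= sumr_const mulr_natr.
Qed.

End Pairing.

(** In the rank factorization of an idempotent the factors multiply, in the reverse order, to the
    identity of size [\rank A]; the trace is invariant under this exchange. *)
Lemma trace_idempotent (K : fieldType) (D : nat) (A : 'M[K]_D) :
  A *m A = A -> \tr A = (\rank A)%:R.
Proof.
move=> AA.
have BC : row_base A *m col_base A = 1%:M.
  apply: (row_full_inj (col_base_full A)); apply: (row_free_inj (row_base_free A)).
  by rewrite mulmx1 mulmxA mulmx_base -mulmxA mulmx_base AA.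
by rewrite -{1}(mulmx_base A) mxtrace_mulC BC mxtrace1.
Qed.

Lemma CrM {R : realType} (x y : R) : Cr (x * y) = Cr x * Cr y.
Proof. by rewrite /Cr; apply/eqP; rewrite eq_complex /= !mulr0 subr0 mul0r addr0 !eqxx. Qed.

Lemma Cr_nat {R : realType} (m : nat) : Cr (m%:R : R) = m%:R.
Proof.
elim: m => [|m IH]; first by [].
by rewrite -[in RHS]natr1 -IH -natr1 /Cr; apply/eqP; rewrite eq_complex /= addr0 !eqxx.
Qed.

(** * The stabilizer projector and its syndrome decoder *)

Section Stabilizer.
Context {R : realType} {F : zmodType} {V : finZmodType} {D : nat}.
Local Notation C := R[i].
Variables (e : F -> C) (B : V -> V -> F).
Hypotheses (e0 : e 0 = 1) (eD : forall a b, e (a + b) = e a * e b).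
Hypothesis e_inj : forall a, a != 0 -> e a != 1.
Hypotheses (BDl : forall x y z, B (x + y) z = B x z + B y z).
Hypotheses (BDr : forall x y z, B z (x + y) = B z x + B z y).
Hypothesis B_nondeg : forall x, x != 0 -> exists y, B y x != 0.

Variables (N : V -> 'M[C]_D) (c : V -> V -> C).
Hypothesis D_gt0 : (0 < D)%N.
Hypothesis N0 : N 0 = 1%:M.
Hypothesis NM : forall x y, N x *m N y = c x y *: N (x + y).
Hypothesis NC : forall x y, N x *m N y = e (B x y) *: (N y *m N x).
Hypothesis NV : forall x, adj (N x) *m N x = 1%:M.

Variable S : pred V.
Hypotheses (S0 : 0 \in S) (SB : forall x y, x \in S -> y \in S -> x - y \in S).
Hypothesis S_isotropic : forall x y, x \in S -> y \in S -> B x y = 0.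

Let NVr x : N x *m adj (N x) = 1%:M.
Proof. exact/mulmx1C/NV. Qed.

Lemma stabilizer_comm x y : x \in S -> y \in S -> N x *m N y = N y *m N x.
Proof. by move=> xS yS; rewrite NC S_isotropic // e0 scale1r. Qed.

Lemma scal1_inj (a b : C) : a *: (1%:M : 'M[C]_D) = b *: 1%:M -> a = b.
Proof.
case: D D_gt0 => // D' _ /matrixP /(_ 0 0).
by rewrite !mxE eqxx !mulr1.
Qed.

Lemma normsq_cocycle x y : normsq (c x y) = 1.
Proof.
have : adj (N x *m N y) *m (N x *m N y) = 1%:M.
  by rewrite adjM -mulmxA (mulmxA (adj (N x))) NV mul1mx NV.
rewrite NM adjZ -scalemxAl -scalemxAr NV scalerA -[in RHS](scale1r 1%:M).
by move/scal1_inj => H; rewrite /normsq H.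
Qed.

Lemma cocycle_neq0 x y : c x y != 0.
Proof.
apply/eqP => c0; have := normsq_cocycle x y; rewrite c0 /normsq mulr0 /=.
by move/eqP; rewrite eq_sym oner_eq0.
Qed.

(** Conjugation by a suitable [N y] preserves the trace but multiplies [N x] by a phase different
    from 1. *)
Lemma trace_error x : x != 0 -> \tr (N x) = 0.
Proof.
move=> /B_nondeg [y By].
have : \tr (N y *m N x *m adj (N y)) = \tr (N x).
  by rewrite -mulmxA mxtrace_mulC -mulmxA NV mulmx1.
rewrite NC -scalemxAl -mulmxA NVr mulmx1 linearZ /= => /eqP.
rewrite -subr_eq0 -{2}[\tr _]mul1r -mulrBl mulf_eq0 subr_eq0.
by rewrite (negPf (e_inj _ By)) => /eqP.
Qed.

(* A common eigenvector of the commuting matrices [N x], [x \in S], supplies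
   phases that make [x |-> N x / lam x] a genuine representation of [S]. *)
Lemma stabilizer_phases : exists lam : V -> C,
  [/\ lam 0 = 1, forall x, x \in S -> normsq (lam x) = 1 &
      forall x y, x \in S -> y \in S -> lam x * lam y = c x y * lam (x + y)].
Proof.
have [|v v0 /allP st] := @common_eigenvector C D [seq N x | x in S] D_gt0.
  move=> A1 A2 /mapP [x xS ->] /mapP [y yS ->]; move: xS yS.
  rewrite !mem_enum => xS yS.
  exact: stabilizer_comm.
have [i vi] : exists i, v 0 i != 0.
  apply/existsP; apply: contraNT v0; rewrite negb_exists => /forallP v0.
  by apply/eqP/rowP => i; rewrite mxE; apply/eqP; move: (v0 i); rewrite negbK.
(* The eigenvalue of [N x] on [v], read off a nonzero coordinate; it is meaningful only for
   [x \in S]. *)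
pose lam x := (v *m N x) 0 i / v 0 i.
have lamE x : x \in S -> v *m N x = lam x *: v.
  move=> xS; have /sub_rVP [a vE] : (v *m N x <= v)%MS by apply/st/map_f; rewrite mem_enum.
  by rewrite /lam vE mxE mulfK.
have v_inj (a b : C) : a *: v = b *: v -> a = b.
  by move/rowP/(_ i); rewrite !mxE => /(mulIf vi).
exists lam; split.
- by rewrite /lam N0 mulmx1 divff.
- move=> x xS.
  have wE : v *m adj v = (lam x * conjc (lam x)) *: (v *m adj v).
    rewrite -scalerA scalemxAr -adjZ -lamE // scalemxAl -lamE //.
    by rewrite adjM mulmxA -(mulmxA v) NVr mulmx1.
  have n0 : (v *m adj v) 0 0 != 0.
    have vT0 : adj v != 0.
      by apply: contra v0 => /eqP E; rewrite -[v]adjK E /adj map_mx0 trmx0.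
    rewrite -{1}[v]adjK adj_mul_col; apply/eqP => -[] /eqP.
    by rewrite (gt_eqF (colnorm_gt0 _ _ vT0)).
  move/matrixP: wE => /(_ 0 0); rewrite [RHS]mxE -{1}[_ 0 0]mul1r => /(mulIf n0) H.
  by rewrite /normsq mulrC -H.
- move=> x y xS yS.
  have xyS : x + y \in S by rewrite (subgroupDr _ S0 SB).
  apply: v_inj; rewrite -[in RHS]scalerA -lamE // scalemxAr -NM mulmxA lamE //.
  by rewrite -scalemxAl lamE // scalerA.
Qed.

(* The decoder is given as a function of the error, but its second hypothesis
   says that it only uses the syndrome of that error. *)
Lemma stabilizer_code (dec : V -> V) :
    (forall y, y - dec y \in perp B S) ->
    (forall x y, x - y \in perp B S -> dec x = dec y) ->
  exists (Cm : 'M[C]_D) (m : nat) (Ks : 'I_m -> 'M[C]_D),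
  [/\ Kraus_TP Ks, (#|S| * \rank Cm)%N = D &
      forall (p : V -> R) (psi : 'rV[C]_D), (forall x, 0 <= p x) ->
        (psi <= Cm)%MS -> (map_mx conjc psi *m psi^T) 0 0 = 1 ->
      \sum_(x | x - dec x \in S) p x <=
      \sum_x p x * \sum_j normsq ((adj psi^T *m (Ks j *m (N x *m psi^T))) 0 0)].
Proof.
move=> decP dec_eq.
have [lam [lam0 lam1 lamM]] := stabilizer_phases.
have SN x : x \in S -> - x \in S by exact: (subgroupN _ S0 SB).
have lamN0 x : x \in S -> lam x != 0.
  move=> /lam1 H; apply/eqP => l0; move: H; rewrite l0 /normsq mulr0 /=.
  by move/eqP; rewrite eq_sym oner_eq0.
have cS : (#|S|%:R : C) != 0.
  by rewrite pnatr_eq0 -lt0n; apply/card_gt0P; exists 0.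
(* This group average is the projector onto the code space, where each [N x] with [x \in S] acts as
   the scalar [lam x]. *)
have [Pi PiE] : {Pi | Pi = #|S|%:R^-1 *: \sum_(x in S) (lam x)^-1 *: N x} by eexists.
have PiN y : y \in S -> Pi *m N y = lam y *: Pi.
  move=> yS; rewrite PiE -scalemxAl scalerA mulrC -scalerA; congr (_ *: _).
  rewrite mulmx_suml scaler_sumr [RHS](reindex_inj (addIr y)) /=.
  apply: eq_big => [x|x xS]; first by rewrite (subgroupDr _ S0 SB).
  rewrite -scalemxAl NM !scalerA; congr (_ *: _).
  have xyS : x + y \in S by rewrite (subgroupDr _ S0 SB).
  apply: (mulfI (lamN0 _ xS)); rewrite mulrA divff ?lamN0 // mul1r.
  by rewrite mulrA lamM // mulfK // lamN0.
have NPi y : y \in S -> N y *m Pi = lam y *: Pi.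
  move=> yS; rewrite -PiN // PiE -scalemxAl -scalemxAr; congr (_ *: _).
  rewrite mulmx_suml mulmx_sumr; apply: eq_bigr => x xS.
  by rewrite -scalemxAl -scalemxAr stabilizer_comm.
have PiPi : Pi *m Pi = Pi.
  rewrite {2}PiE -scalemxAr mulmx_sumr.
  transitivity (#|S|%:R^-1 *: \sum_(x in S) Pi).
    congr (_ *: _); apply: eq_bigr => x xS.
    by rewrite -scalemxAr PiN // scalerA mulVf ?lamN0 // scale1r.
  by rewrite sumr_const -(scaler_nat #|S| (Pi : 'M[C]_D)) scalerA mulVf // scale1r.
have adjPi : adj Pi = Pi.
  rewrite PiE adjZ adj_sum conjc_inv conjc_nat; congr (_ *: _).
  rewrite [RHS](reindex_inj oppr_inj) /=.
  apply: eq_big => [x|x xS].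
    by apply/idP/idP => xS; [exact: SN|rewrite -[x]opprK SN].
  rewrite adjZ conjc_inv.
  have -> : (conjc (lam x))^-1 = lam x.
    apply: (mulfI (x := conjc (lam x))); first by rewrite conjc_eq0 lamN0.
    by rewrite divff ?conjc_eq0 ?lamN0 // normsq_Re lam1.
  have -> : adj (N x) = (c x (- x))^-1 *: N (- x).
    apply: (canRL (scalerK (cocycle_neq0 _ _))).
    rewrite -[adj _]mulmx1 -N0 -(subrr x) scalemxAr -NM mulmxA NV.
    by rewrite mul1mx.
  rewrite scalerA; congr (_ *: _).
  have xNS := SN x xS.
  have := lamM _ _ xS xNS; rewrite subrr lam0 mulr1 => <-.
  by rewrite invfM mulrA divff ?lamN0 // mul1r.
(* The rank of an idempotent is its trace, to which only the term [x = 0] of the average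
   contributes. *)
have rkPi : (#|S| * \rank Pi)%N = D.
  apply/eqP; rewrite -(eqr_nat C) natrM -trace_idempotent // PiE linearZ /=.
  rewrite mulrA divff // mul1r raddf_sum (bigD1 0) //= big1 ?addr0.
    by rewrite lam0 invr1 scale1r N0 mxtrace1.
  by move=> x /andP[_ x0]; rewrite linearZ /= trace_error // mulr0.
(* The Kraus operators are indexed by all of [V] and not by syndromes, so each syndrome is repeated
   [#|V| / #|S|] times; the weight [al] compensates for this. *)
pose al : R := Num.sqrt (#|S|%:R / #|V|%:R).
have al2 : al * al = #|S|%:R / #|V|%:R by rewrite -expr2 sqr_sqrtr // divr_ge0.
have cV : (#|V|%:R : R) != 0.
  by rewrite pnatr_eq0 -lt0n; apply/card_gt0P; exists 0.
have cSR : (#|S|%:R : R) != 0.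
  by rewrite pnatr_eq0 -lt0n; apply/card_gt0P; exists 0.
pose K y := Cr al *: (Pi *m adj (N (dec y))).
(* [dec y] has the syndrome of [y], so the phases produced by the corrections form a full character
   sum over [V], which leaves only the identity in the expansion of [Pi]. *)
have eB y x : x \in S -> e (B (dec y) x) = e (B y x).
  move=> xS; move/perpP: (decP y) => /(_ _ xS).
  rewrite BDl (formNl _ BDl) => /eqP; rewrite subr_eq0 => /eqP.
  by move=> ->.
have TP : \sum_y adj (K y) *m K y = 1%:M.
  transitivity (\sum_y Cr (al * al) *: (N (dec y) *m Pi *m adj (N (dec y)))).
    apply: eq_bigr => y _; rewrite /K adjZ conjcCr -scalemxAl -scalemxAr scalerA.
    rewrite CrM; congr (_ *: _).
    by rewrite adjM adjK adjPi !mulmxA -(mulmxA _ Pi Pi) PiPi.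
  transitivity (Cr (al * al) *: (#|S|%:R^-1 *:
     \sum_(x in S) (lam x)^-1 *: ((\sum_y e (B y x)) *: N x))).
    rewrite -scaler_sumr; congr (_ *: _); rewrite PiE.
    under eq_bigr => y _ do rewrite -scalemxAr -scalemxAl mulmx_sumr mulmx_suml.
    rewrite -scaler_sumr; congr (_ *: _); rewrite exchange_big /=.
    apply: eq_bigr => x xS; rewrite scaler_suml scaler_sumr.
    apply: eq_bigr => y _; rewrite -scalemxAr -scalemxAl; congr (_ *: _).
    by rewrite NC -scalemxAl -mulmxA NVr mulmx1 eB.
  under eq_bigr => x _ do
    rewrite (sum_character e B e0 eD e_inj BDl BDr B_nondeg).
  rewrite (bigD1 0) //= big1 ?addr0; last first.
    by move=> x /andP[_ x0]; rewrite (negPf x0) scale0r scaler0.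
  rewrite eqxx lam0 invr1 scale1r.
  rewrite N0 !scalerA al2 -[in RHS](scale1r 1%:M); congr (_ *: _).
  by rewrite mulrAC -[X in _ * X / _]Cr_nat -CrM divfK // Cr_nat divff.
(* A code is the row space of transposed kets, hence the transpose. *)
exists Pi^T, #|V|, (fun j => K (enum_val j)); split.
- rewrite /Kraus_TP -TP [RHS](reindex (fun j : 'I_#|V| => enum_val j)) //=.
  exact/onW_bij/enum_val_bij.
- by rewrite mxrank_tr.
move=> p psi p0 psiPi psi1; rewrite big_mkcond /=; apply: ler_sum => x _.
case: ifPn => [good|_]; last first.
  by rewrite mulr_ge0 // sumr_ge0 // => j _; exact: normsq_ge0.
rewrite -[leLHS]mulr1; apply: ler_wpM2l => //.
set f := psi^T.
have Pif : Pi *m f = f.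
  by have /submxP [a aE] := psiPi; rewrite /f aE trmx_mul trmxK mulmxA PiPi.
have fPi : adj f *m Pi = adj f by rewrite -[in LHS]adjPi -adjM Pif.
have f1 : (adj f *m f) 0 0 = 1 by rewrite -conjmx_adj.
have -> : \sum_(j < #|V|) normsq ((adj f *m (K (enum_val j) *m (N x *m f))) 0 0) =
          \sum_y normsq ((adj f *m (K y *m (N x *m f))) 0 0).
  rewrite [RHS](reindex (fun j : 'I_#|V| => enum_val j)) //=.
  exact/onW_bij/enum_val_bij.
(* Only the indices [y] with the syndrome of [x] are kept, [#|perp B S|] in number. Each contributes
   [al * al], because the residual error [x - dec x] lies in [S] and acts on the code as a scalar of
   modulus 1. *)
rewrite (bigID (fun y => y - x \in perp B S)) /=.
apply: (@le_trans _ _ (\sum_(y | y - x \in perp B S) (al * al))); last first.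
  rewrite ler_wpDr // ?sumr_ge0 // => [j _|]; first exact: normsq_ge0.
  apply: ler_sum => y yx; rewrite (_ : normsq _ = al * al) //.
  rewrite /K (dec_eq _ _ yx) -scalemxAl -scalemxAr mxE normsqM.
  have -> : normsq (Cr al) = al * al by rewrite /normsq /Cr /= oppr0 mul0r subr0.
  rewrite -[RHS]mulr1; congr (_ * _).
  set w := adj (N (dec x)) *m (N x *m f).
  have -> : adj f *m (Pi *m adj (N (dec x)) *m (N x *m f)) = adj f *m w.
    by rewrite -[Pi *m _ *m _]mulmxA [adj f *m (Pi *m _)]mulmxA fPi.
  pose z := x - dec x.
  have cw : c (dec x) z *: w = lam z *: f.
    rewrite /w scalemxAr scalemxAl.
    have <- : N (dec x) *m N z = c (dec x) z *: N x by rewrite NM /z [dec x + _]addrC subrK.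
    rewrite !mulmxA NV mul1mx -{1}Pif mulmxA NPi //.
    by rewrite -scalemxAl Pif.
  have : normsq (c (dec x) z * (adj f *m w) 0 0) = normsq (lam z * (adj f *m f) 0 0).
    have sE (a : C) (X : 'M[C]_1) : a * X 0 0 = (a *: X) 0 0 by rewrite mxE.
    by rewrite !sE (scalemxAr _ _ w) (scalemxAr _ _ f) cw.
  by rewrite !normsqM normsq_cocycle mul1r => ->; rewrite lam1 // f1 /normsq /= !mul1r oppr0 mul0r subr0.
rewrite sumr_const -mulr_natr al2.
have <- : #|perp B S| = #|[pred y | y - x \in perp B S]|.
  rewrite -!sum1_card [LHS](reindex_inj (addIr (- x))) /=.
  by apply: eq_bigl => y.
rewrite -(card_perp e B e0 eD e_inj BDl BDr B_nondeg S S0 SB) natrM.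
have cP : (#|perp B S|%:R : R) != 0.
  by rewrite pnatr_eq0 -lt0n; apply/card_gt0P; exists 0; exact: perp0.
rewrite le_eqVlt; apply/orP; left; apply/eqP; field.
by rewrite cP cSR.
Qed.

End Stabilizer.

(** * Generalized Pauli operators *)

Section Pauli.
Context {R : realType} {d : nat} {omega : R[i]}.
Local Notation C := R[i].
Hypotheses (d_prime : prime d) (omega_prim : d.-primitive_root omega).

Definition phase (a : 'F_d) : C := omega ^+ val a.

Lemma phase0 : phase 0 = 1.
Proof. by rewrite /phase expr0. Qed.

Lemma phase_nat m : phase m%:R = omega ^+ m.
Proof. by rewrite /phase /= val_Fp_nat // (expr_mod m (prim_expr_order omega_prim)). Qed.

Lemma phaseD a b : phase (a + b) = phase a * phase b.
Proof.
by rewrite -[a]natr_Zp -[b]natr_Zp -natrD !phase_nat exprD.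
Qed.

Lemma phase_neq1 a : a != 0 -> phase a != 1.
Proof.
apply: contra => /eqP a1.
have : (d %| val a)%N by rewrite (prim_order_dvd omega_prim); apply/eqP.
rewrite /dvdn modn_small => [/eqP a0|]; first exact/eqP/val_inj.
by apply: leq_trans (ltn_ord a) _; rewrite Fp_cast.
Qed.

Lemma conjc_phase a : conjc (phase a) * phase a = 1.
Proof.
rewrite /phase rmorphXn -exprMn.
suff -> : conjc omega * omega = 1 by rewrite expr1n.
rewrite mulrC -sqr_normc.
suff -> : `|omega| = 1 by rewrite expr1n.
apply/eqP; rewrite -(pexpr_eq1 (prime_gt0 d_prime)) ?normr_ge0 //.
by rewrite -normrX (prim_expr_order omega_prim) normr1.
Qed.

(** Basis labels live in ['I_d] and exponents in ['F_d], types that are not convertible for a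
    variable [d]; this bijection allows field arithmetic on labels. *)
Definition ordF (i : 'I_d) : 'F_d := (i : nat)%:R.

Lemma ordF_inj : injective ordF.
Proof.
move=> i j /(congr1 val); rewrite /= !val_Fp_nat // !modn_small //.
exact: val_inj.
Qed.

Lemma ordF_bij : bijective ordF.
Proof. by apply: inj_card_bij ordF_inj _; rewrite card_Fp // card_ord. Qed.

Lemma sum_ordF (f : 'I_d -> C) (b : 'F_d) (i : 'I_d) : ordF i = b ->
  \sum_j (if ordF j == b then f j else 0) = f i.
Proof.
move=> ib; rewrite -big_mkcond (big_pred1 i) // => j.
by rewrite -ib (inj_eq ordF_inj).
Qed.

Lemma ordF_surj b : exists i, ordF i = b.
Proof. by case: ordF_bij => f fK Kf; exists (f b). Qed.

Lemma shiftX_exp m (a b : 'I_d) :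
  ((@shiftX R d) ^+ m) a b = (ordF b == ordF a + m%:R)%:R.
Proof.
elim: m a b => [|m IH] a b.
  by rewrite expr0 mxE addr0 (inj_eq ordF_inj) eq_sym.
rewrite exprS mxE.
have [c cE] := ordF_surj (ordF a + 1).
transitivity (\sum_j (if ordF j == ordF a + 1 then (ordF b == ordF j + m%:R)%:R else 0 : C)).
  apply: eq_bigr => j _; rewrite IH !mxE.
  have -> : ((a : nat) == ((j : nat) + d.-1) %% d)%N = (ordF j == ordF a + 1).
    have jE : ordF j - 1 = ((j : nat) + d.-1)%:R.
      rewrite natrD; congr (_ + _); apply/eqP; rewrite eq_sym -subr_eq0 opprK natr1.
      by rewrite prednK ?prime_gt0 // pchar_Fp_0.
    rewrite -subr_eq jE /ordF -[RHS](inj_eq val_inj) [RHS]eq_sym /= !val_Fp_nat //.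
    by rewrite (modn_small (ltn_ord a)).
  by case: ifP => _; rewrite ?mul1r ?mul0r.
by rewrite (sum_ordF _ _ _ cE) cE -addrA nat1r.
Qed.

Lemma phaseZ_exp m (a b : 'I_d) :
  ((phaseZ d omega) ^+ m) a b = if a == b then phase (m%:R * ordF b) else 0.
Proof.
elim: m a b => [|m IH] a b.
  by rewrite expr0 mxE mul0r phase0; case: eqP.
rewrite exprS mxE (bigD1 a) //= big1 ?addr0 => [|j /negPf ja]; last first.
  by rewrite mxE eq_sym ja mul0r.
rewrite mxE eqxx IH; case: eqP => [->|_]; last by rewrite mulr0.
by rewrite -phase_nat -phaseD -nat1r mulrDl mul1r.
Qed.

Lemma NpauliE u (a b : 'I_d) :
  Npauli d omega u a b =
  if ordF b == ordF a + u.1 then phase (u.2 * ordF b) else 0.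
Proof.
rewrite /Npauli mxE (bigD1 b) //= big1 ?addr0 => [|j /negPf jb]; last first.
  by rewrite phaseZ_exp jb mulr0.
rewrite shiftX_exp phaseZ_exp eqxx !natr_Zp.
by case: eqP; rewrite ?mul1r ?mul0r.
Qed.

Lemma Npauli0 : Npauli d omega 0 = 1%:M.
Proof.
apply/matrixP=> a b; rewrite NpauliE mxE /= addr0 mul0r phase0 (inj_eq ordF_inj) eq_sym.
by case: eqP.
Qed.

(** The phase is the price of moving [Z^u.2] past [X^v.1]; its sign is negative because [X] lowers
    the basis label, so that [Z X = omega^-1 X Z]. *)
Lemma NpauliM u v :
  Npauli d omega u *m Npauli d omega v = phase (- (u.2 * v.1)) *: Npauli d omega (u + v).
Proof.
apply/matrixP=> a b; rewrite [LHS]mxE [RHS]mxE.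
have [c cE] := ordF_surj (ordF a + u.1).
under eq_bigr => j _ do rewrite !NpauliE.
transitivity (\sum_j (if ordF j == ordF a + u.1 then phase (u.2 * ordF j) *
   (if ordF b == ordF j + v.1 then phase (v.2 * ordF b) else 0) else 0)).
  by apply: eq_bigr => j _; case: ifP; rewrite ?mul0r.
rewrite (sum_ordF _ _ _ cE) NpauliE cE /= addrA; case: eqP => [bE|_]; last by rewrite !mulr0.
rewrite -!phaseD; congr phase.
by rewrite bE; ring.
Qed.

Lemma NpauliV u : adj (Npauli d omega u) *m Npauli d omega u = 1%:M.
Proof.
apply/matrixP=> a b; rewrite [LHS]mxE [RHS]mxE.
have [c cE] := ordF_surj (ordF a - u.1).
transitivity (\sum_j (if ordF j == ordF a - u.1 then
    conjc (phase (u.2 * ordF a)) * (if ordF b == ordF j + u.1 then phase (u.2 * ordF b) else 0)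
    else 0)).
  apply: eq_bigr => j _; rewrite adjE !NpauliE.
  rewrite [ordF j == _]eq_sym subr_eq; case: ifP => _ //.
  by rewrite rmorph0 mul0r.
rewrite (sum_ordF _ _ _ cE) cE subrK (inj_eq ordF_inj) eq_sym.
by case: eqP => [->|_]; rewrite ?conjc_phase ?mulr0.
Qed.

End Pauli.

Section Tensor.
Context {R : realType} {d M : nat}.
Local Notation C := R[i].

(** The matrix of [Ntens] with arbitrary factors, so that products and adjoints can be computed
    factor by factor. *)
Definition tensmx (A : 'I_M -> 'M[C]_d) : 'M[C]_#|QBasis d M| :=
  \matrix_(a, b) \prod_(i < M)
     A i (@enum_val (QBasis d M) predT a i) (@enum_val (QBasis d M) predT b i).

Lemma tensmxM A B : tensmx A *m tensmx B = tensmx (fun i => A i *m B i).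
Proof.
apply/matrixP => a b; rewrite !mxE.
under [RHS]eq_bigr => i _ do rewrite mxE.
rewrite bigA_distr_bigA /= [RHS](reindex (fun j => @enum_val (QBasis d M) predT j)) /=.
  by apply: eq_bigr => j _; rewrite !mxE -big_split.
exact/onW_bij/enum_val_bij.
Qed.

Lemma adj_tensmx A : adj (tensmx A) = tensmx (fun i => adj (A i)).
Proof.
apply/matrixP => a b; rewrite !mxE rmorph_prod; apply: eq_bigr => i _.
by rewrite !mxE.
Qed.

Lemma tensmx1 : tensmx (fun=> 1%:M) = 1%:M.
Proof.
apply/matrixP => a b; rewrite !mxE.
case: (a =P b) => [->|ab].
  by rewrite big1 // => i _; rewrite mxE eqxx.
have [i abi] : exists i, @enum_val (QBasis d M) predT a i != @enum_val (QBasis d M) predT b i.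
  apply/existsP; apply: contra_notT ab; rewrite negb_exists => /forallP ab.
  by apply: enum_val_inj; apply/ffunP => i; apply/eqP; move: (ab i); rewrite negbK.
by rewrite (bigD1 i) //= mxE (negPf abi) mul0r.
Qed.

Lemma tensmxZ (c : 'I_M -> C) A : tensmx (fun i => c i *: A i) = (\prod_i c i) *: tensmx A.
Proof.
apply/matrixP => a b; rewrite !mxE -big_split; apply: eq_bigr => i _.
by rewrite !mxE.
Qed.

Lemma eq_tensmx A B : A =1 B -> tensmx A = tensmx B.
Proof. by move=> AB; apply/matrixP => a b; rewrite !mxE; apply: eq_bigr => i _; rewrite AB. Qed.

End Tensor.

Section PauliTensor.
Context {R : realType} {d : nat} {omega : R[i]} {M : nat}.
Local Notation C := R[i].
Hypotheses (d_prime : prime d) (omega_prim : d.-primitive_root omega).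
Local Notation phase := (@phase R d omega).
Implicit Types x y : {ffun 'I_M -> 'F_d * 'F_d}.

Lemma NtensE x : Ntens d omega M x = tensmx (fun i => Npauli d omega (x i)).
Proof. by []. Qed.

Lemma Ntens0 : Ntens d omega M 0 = 1%:M.
Proof.
rewrite NtensE -tensmx1; apply: eq_tensmx => i; rewrite ffunE.
exact: (Npauli0 d_prime omega_prim).
Qed.

Lemma NtensV x : adj (Ntens d omega M x) *m Ntens d omega M x = 1%:M.
Proof.
rewrite NtensE adj_tensmx tensmxM -tensmx1; apply: eq_tensmx => i.
exact: (NpauliV d_prime omega_prim).
Qed.

Lemma prod_phase (f : 'I_M -> 'F_d) : \prod_i phase (f i) = phase (\sum_i f i).
Proof.
apply/esym/big_morph; first exact: (phaseD d_prime omega_prim).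
exact: phase0.
Qed.

Lemma NtensM x y : Ntens d omega M x *m Ntens d omega M y =
  phase (- \sum_i (x i).2 * (y i).1) *: Ntens d omega M (x + y).
Proof.
rewrite !NtensE tensmxM -sumrN -prod_phase -tensmxZ; apply: eq_tensmx => i.
by rewrite (NpauliM d_prime omega_prim) ffunE.
Qed.

(** Both orders give the same operator up to a phase, and the quotient of the two phases is governed
    by the symplectic form; isotropic sets of errors therefore commute. *)
Lemma NtensC x y : Ntens d omega M x *m Ntens d omega M y =
  phase (\sum_i ((x i).1 * (y i).2 - (x i).2 * (y i).1)) *:
    (Ntens d omega M y *m Ntens d omega M x).
Proof.
rewrite !NtensM scalerA -(phaseD d_prime omega_prim) [y + x]addrC; congr (phase _ *: _).
rewrite big_split /= sumrN addrAC -[LHS]add0r; congr (_ + _).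
by apply/esym/eqP; rewrite subr_eq0; apply/eqP/eq_bigr => i _; exact: mulrC.
Qed.

End PauliTensor.

(** * The ensemble of symplectic isometries *)

Section SymplecticEnsemble.
Context {F : finFieldType} {V : finLmodType F}.
Variable B : V -> V -> F.
Hypotheses (BDl : forall x y z, B (x + y) z = B x z + B y z).
Hypotheses (BDr : forall x y z, B z (x + y) = B z x + B z y).
Hypotheses (BZl : forall a x y, B (a *: x) y = a * B x y).
Hypotheses (BZr : forall a x y, B x (a *: y) = a * B x y).
Hypothesis Balt : forall x, B x x = 0.
Hypothesis B_nondeg : forall x, x != 0 -> exists y, B y x != 0.

(** A decidable predicate on a finite type, so that probabilities over the ensemble are ratios of
    cardinals. Additivity is stated through differences, the form in which cosets are compared. *)
Definition isometryb (s : {ffun V -> V}) : bool :=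
  [forall x, forall y, (s (x - y) == s x - s y) && (B (s x) (s y) == B x y)].

Lemma isometryP (s : {ffun V -> V}) :
  reflect ((forall x y, s (x - y) = s x - s y) /\ (forall x y, B (s x) (s y) = B x y))
          (isometryb s).
Proof.
apply: (iffP idP) => [H|[H1 H2]].
  by split=> x y; have /forallP/(_ x)/forallP/(_ y)/andP[/eqP ? /eqP ?] := H.
by apply/forallP => x; apply/forallP => y; rewrite H1 H2 !eqxx.
Qed.

Lemma isometry0 s : isometryb s -> s 0 = 0.
Proof. by move=> /isometryP[sB _]; have := sB 0 0; rewrite !subrr. Qed.

Lemma isometry_inj s : isometryb s -> injective s.
Proof.
move=> si x y sxy; apply/eqP; rewrite -subr_eq0; apply: contraT => /B_nondeg [z].
have /isometryP[sB sF] := si.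
by rewrite -sF sB sxy subrr (form_x0 B BDr) eqxx.
Qed.

Lemma isometry_comp s t : isometryb s -> isometryb t -> isometryb [ffun x => s (t x)].
Proof.
move=> /isometryP[sB sF] /isometryP[tB tF]; apply/isometryP.
by split=> x y; rewrite !ffunE ?tB ?sB // sF tF.
Qed.

Lemma formC x y : B x y = - B y x.
Proof.
apply/eqP; rewrite -subr_eq0 opprK; apply/eqP.
by have := Balt (x + y); rewrite BDl !BDr !Balt add0r addr0.
Qed.

(** Symplectic transvections: the term quadratic in [a] vanishes since [B v v = 0], and the two
    linear ones cancel by antisymmetry. *)
Lemma transvection_isometry (a : F) (v : V) :
  isometryb [ffun x => x + (a * B x v) *: v].
Proof.
apply/isometryP; split=> x y; rewrite !ffunE.
  rewrite BDl (formNl B BDl) mulrBr scalerBl opprD !addrA; congr (_ + _).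
  by rewrite -!addrA; congr (_ + _); exact: addrC.
rewrite BDl !BDr !BZl !BZr Balt (formC v y) !mulr0 addr0.
by ring.
Qed.

(** The transvection along [y - x], scaled by the inverse of [B x (y - x) = B x y], moves [x] by
    exactly [y - x]. *)
Lemma isometry_step x y : B x y != 0 -> exists2 s, isometryb s & s x = y.
Proof.
move=> xy; exists [ffun z => z + ((B x y)^-1 * B z (y - x)) *: (y - x)].
  exact: transvection_isometry.
by rewrite ffunE BDr [B x (- x)]formC (formNl B BDl) Balt !oppr0 addr0 mulVf // scale1r addrC subrK.
Qed.

(** One transvection fails when [x] and [y] are orthogonal, so the path goes through some [z]
    orthogonal to neither; if no single witness of nondegeneracy serves both, the sum of two
    does. *)
Lemma isometry_transitive x y : x != 0 -> y != 0 -> exists2 s, isometryb s & s x = y.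
Proof.
move=> x0 y0.
have [z zx zy] : exists2 z, B z x != 0 & B z y != 0.
  have [z1 z1x] := B_nondeg _ x0; have [z2 z2y] := B_nondeg _ y0.
  case: (eqVneq (B z1 y) 0) => [z1y|]; last by exists z1.
  case: (eqVneq (B z2 x) 0) => [z2x|]; last by exists z2.
  by exists (z1 + z2); rewrite BDl ?z2x ?z1y ?addr0 ?add0r.
have [s si sx] : exists2 s, isometryb s & s x = z.
  by apply: isometry_step; rewrite formC oppr_eq0.
have [t ti ty] := isometry_step _ _ zy.
by exists [ffun x => t (s x)]; [exact: isometry_comp|rewrite ffunE sx].
Qed.

(** Precomposition with an isometry that takes [x] to [y] injects the first set into the second. *)
Lemma isometry_hit_le (W : pred V) x y : x != 0 -> y != 0 ->
  (#|[pred s | isometryb s && (s y \in W)]| <= #|[pred s | isometryb s && (s x \in W)]|)%N.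
Proof.
move=> x0 y0; have [t ti tx] := isometry_transitive _ _ x0 y0.
pose h (s : {ffun V -> V}) : {ffun V -> V} := [ffun z => s (t z)].
have [t' tK t'K] := injF_bij (isometry_inj _ ti).
have h_inj : injective h.
  move=> s1 s2 /ffunP H; apply/ffunP => z.
  by have := H (t' z); rewrite !ffunE t'K.
rewrite -(card_image h_inj); apply/subset_leq_card/fintype.subsetP => _ /fintype.imageP [s /andP[si sy] ->].
by rewrite inE isometry_comp //= ffunE tx.
Qed.

(* By transitivity every nonzero vector is hit equally often, hence at most as often
   as a uniformly distributed vector would be. *)
Lemma isometry_hit (W : pred V) y : 0 \in W -> y != 0 ->
  (#|[pred s | isometryb s && (s y \in W)]| * #|V| <= #|[pred s | isometryb s]| * #|W|)%N.
Proof.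
move=> W0 y0; set f := #|[pred s | isometryb s && (s y \in W)]|; set G := #|[pred s | isometryb s]|.
have fG : (f <= G)%N by apply/subset_leq_card/fintype.subsetP => s; rewrite !inE => /andP[].
(* Count pairs of a nonzero [x] and an isometry [s] with [s x \in W]: an isometry is injective and
   fixes 0, so it contributes at most the nonzero elements of [W]. *)
have sumf : (\sum_(x : V | x != 0%R) f <= \sum_(s | isometryb s) #|[pred x in W | x != 0%R]|)%N.
  apply: (@leq_trans (\sum_(x : V | x != 0%R) \sum_(s | isometryb s) (s x \in W))%N).
    apply: leq_sum => x x0; rewrite -big_mkcondr sum1_card /=.
    exact: isometry_hit_le.
  rewrite exchange_big /=; apply: leq_sum => s si.
  rewrite -big_mkcondr sum1_card -(card_image (isometry_inj _ si)).
  apply/subset_leq_card/fintype.subsetP => _ /fintype.imageP [x /andP[x0 xW] ->].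
  rewrite inE /= xW /=; apply: contra x0 => /eqP sx.
  by apply/eqP/(isometry_inj _ si); rewrite sx isometry0.
move: sumf; rewrite !sum_nat_const.
have cardD (A : pred V) : 0 \in A -> #|[pred x in A | x != 0]| = #|A|.-1.
  by move=> A0; rewrite (cardD1 0 A) A0 /=; apply: eq_card => x; rewrite !inE andbC.
have -> : #|[pred x : V | x != 0]| = #|V|.-1.
  by rewrite -(cardD predT) //; apply: eq_card => x; rewrite !inE.
rewrite cardD // -/G.
have : (0 < #|W|)%N by apply/card_gt0P; exists 0.
have : (0 < #|V|)%N by apply/card_gt0P; exists 0.
(* Adding [f <= G] to [f * (v - 1) <= G * (w - 1)] removes both decrements. *)
move: #|V| #|W| => v w v0 w0 H.
rewrite -(prednK v0) -(prednK w0) !mulnS; lia.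
Qed.

End SymplecticEnsemble.

(** * Existence of a good isometry by averaging *)

Section RandomCoding.
Context {R : realType} {F : finFieldType} {V : finLmodType F} {Y : finType}.
Variable B : V -> V -> F.
Hypotheses (BDl : forall x y z, B (x + y) z = B x z + B y z).
Hypotheses (BDr : forall x y z, B z (x + y) = B z x + B z y).
Hypotheses (BZl : forall a x y, B (a *: x) y = a * B x y).
Hypotheses (BZr : forall a x y, B x (a *: y) = a * B x y).
Hypothesis Balt : forall x, B x x = 0.
Hypothesis B_nondeg : forall x, x != 0 -> exists y, B y x != 0.
Variable T : pred V.
Hypothesis card_T : (#|T| * #|perp B T|)%N = #|V|.
Hypothesis T_gt0 : (0 < #|T|)%N.

(** A union bound over the competitors [u'] that are at least as likely as [u]: each nonzero
    [u' - u] lands in [perp B T] for a fraction of at most [#|perp B T| / #|V| = 1 / #|T|] of the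
    isometries. The minimum with 1 is the trivial bound on a probability. *)
Lemma random_coding (p : Y -> V -> R) : (forall s u, 0 <= p s u) ->
  exists2 g, isometryb B g &
  \sum_s \sum_(u | [exists u', [&& u' != u, g (u' - u) \in perp B T & p s u <= p s u']]) p s u
  <= \sum_s \sum_u p s u * Num.min 1 (#|[pred u' | p s u <= p s u']|%:R / #|T|%:R).
Proof.
move=> p0; set b := \sum_s \sum_u p s u * Num.min 1 (#|[pred u' | p s u <= p s u']|%:R / #|T|%:R).
pose bad g s u := [exists u', [&& u' != u, g (u' - u) \in perp B T & p s u <= p s u']].
pose G := [pred g | isometryb B g].
have T0R : 0 < (#|T|%:R : R) by rewrite ltr0n.
have count s u : \sum_(g in G) (bad g s u)%:R <=
    #|G|%:R * Num.min 1 (#|[pred u' | p s u <= p s u']|%:R / #|T|%:R) :> R.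
  rewrite minr_pMr //; rewrite le_min; apply/andP; split.
    rewrite mulr1 -sumr_const; apply: ler_sum => g _.
    by case: (bad g s u); rewrite ?lexx ?ler01.
  apply: (@le_trans _ _ (\sum_(u' | p s u <= p s u') (#|G|%:R / #|T|%:R))); last first.
    by rewrite sumr_const -(mulr_natr (_ / _)) mulrAC -mulrA; exact: lexx.
  apply: (@le_trans _ _ (\sum_(u' | p s u <= p s u')
      \sum_(g in G) ((u' != u) && (g (u' - u) \in perp B T))%:R)).
    rewrite exchange_big /=; apply: ler_sum => g _.
    case: (boolP (bad g s u)) => [/existsP [u' /and3P[u1 u2 u3]]|_].
      by rewrite (bigD1 u') //= u1 u2 lerDl sumr_ge0.
    by rewrite sumr_ge0.
  apply: ler_sum => u' _; case: (eqVneq u' u) => [_|uu'].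
    by rewrite big1 ?divr_ge0.
  rewrite -natr_sum -big_mkcondr sum1_card /= ler_pdivlMr // -natrM ler_nat.
  have := isometry_hit B BDl BDr BZl BZr Balt B_nondeg (perp B T) (u' - u) (perp0 B BDl T).
  rewrite subr_eq0 uu' => /(_ isT); rewrite -card_T mulnCA mulnA.
  have P0 : (0 < #|perp B T|)%N.
    by apply/card_gt0P; exists 0; exact: perp0.
  rewrite [(_ * #|perp B T|)%N]mulnC (mulnC #|G|) leq_pmul2l //.
  by rewrite mulnC.
(* If every isometry exceeded the bound, so would their average. *)
apply: contrapT => H.
have G0 : (0 < #|G|)%N.
  apply/card_gt0P; exists [ffun x => x]; apply/isometryP.
  by split=> x y; rewrite !ffunE.
have : \sum_(g in G) \sum_s \sum_(u | bad g s u) p s u <= #|G|%:R * b.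
  rewrite exchange_big /= mulr_sumr; apply: ler_sum => s _.
  under eq_bigr => g _ do rewrite big_mkcond.
  rewrite exchange_big mulr_sumr /=; apply: ler_sum => u _.
  rewrite mulrCA; apply: le_trans (ler_wpM2l (p0 s u) (count s u)).
  rewrite mulr_sumr; apply: ler_sum => g _.
  by case: (bad g s u); rewrite ?mulr1 ?mulr0.
apply/negP; rewrite -ltNge mulrC (mulr_natr b) -sumr_const.
apply: ltr_sum; first by have /card_gt0P [g gG] := G0; apply/hasP; exists g; rewrite ?mem_index_enum.
by move=> g gG; rewrite ltNge; apply/negP => gb; apply: H; exists g.
Qed.

End RandomCoding.

(** * Gallager's bound and its dual form *)

Section Gallager.
Context {R : realType}.

Lemma powR_prod (I : finType) (f : I -> R) (a : R) : (forall i, 0 <= f i) ->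
  (\prod_i f i) `^ a = \prod_i (f i) `^ a.
Proof.
move=> f0; suff [] : 0 <= \prod_i f i /\ (\prod_i f i) `^ a = \prod_i (f i) `^ a by [].
elim/big_rec2: _ => [|i x y _ [y0 <-]]; first by rewrite powR1.
by rewrite mulr_ge0 // powRM.
Qed.

(** Gallager's function, in exponentiated form, for a source [u] with side information [s] at the
    decoder. *)
Definition gallager {Y Z : finType} (q : Y -> Z -> R) (rho : R) : R :=
  \sum_s (\sum_u q s u `^ (1 + rho)^-1) `^ (1 + rho).

Lemma gallager_prod (Y Z : finType) (q : Y -> Z -> R) (N : nat) (rho : R) :
  (forall s u, 0 <= q s u) ->
  gallager (fun (s : {ffun 'I_N -> Y}) (u : {ffun 'I_N -> Z}) => \prod_b q (s b) (u b)) rho =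
  gallager q rho ^+ N.
Proof.
move=> q0; rewrite /gallager.
transitivity (\prod_(b < N) \sum_s (\sum_u q s u `^ (1 + rho)^-1) `^ (1 + rho)); last first.
  by rewrite prodr_const card_ord.
rewrite bigA_distr_bigA; apply: eq_bigr => s _.
rewrite -powR_prod => [|b]; last by rewrite sumr_ge0 // => u _; rewrite powR_ge0.
congr (_ `^ _); rewrite bigA_distr_bigA; apply: eq_bigr => u _.
by rewrite powR_prod.
Qed.

(* Gallager's bound: [min 1 x <= x ^ rho] together with
   [#{u' | p u <= p u'} <= \sum_u' (p u' / p u) ^ (1 + rho)^-1]. *)
Lemma gallager_bound (V : finType) (p : V -> R) (t rho : R) :
  (forall u, 0 <= p u) -> 0 < t -> 0 <= rho <= 1 ->
  \sum_u p u * Num.min 1 (#|[pred u' | p u <= p u']|%:R / t)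
  <= t `^ (- rho) * (\sum_u p u `^ (1 + rho)^-1) `^ (1 + rho).
Proof.
move=> p0 t0 /andP[r0 r1]; set a := (1 + rho)^-1; set A := \sum_u p u `^ a.
have A0 : 0 <= A by rewrite sumr_ge0 // => u _; exact: powR_ge0.
have rr0 : 1 + rho != 0 by lra.
have a0 : 0 <= a by rewrite invr_ge0; lra.
have an0 : a != 0 by rewrite invr_eq0.
(* One factor [A] is expanded back into its sum over [u], which reduces the claim to single
   terms. *)
have -> : A `^ (1 + rho) = A * A `^ rho.
  by rewrite powRD ?(negPf rr0) // powRr1.
rewrite mulrCA {1}/A mulr_suml; apply: ler_sum => u _.
case: (eqVneq (p u) 0) => [->|pu0]; first by rewrite mul0r powR0 // mul0r.
have pu : 0 < p u by rewrite lt_neqAle eq_sym pu0 p0.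
set n := #|_|.
have n0 : (0 < n)%N by apply/card_gt0P; exists u; rewrite inE.
have x0 : 0 < n%:R / t by rewrite divr_gt0 // ltr0n.
have pa0 : 0 < p u `^ a by exact: powR_gt0.
have nA : n%:R <= A / p u `^ a.
  rewrite ler_pdivlMr // mulr_natl -sumr_const /A [leRHS](bigID (mem [pred u' | p u <= p u'])) /=.
  rewrite ler_wpDr // ?sumr_ge0 // => [u' _|]; first exact: powR_ge0.
  by apply: ler_sum => u' pu'; rewrite ge0_ler_powR ?nnegrE.
have minx : Num.min 1 (n%:R / t) <= (n%:R / t) `^ rho.
  rewrite ge_min; case: (leP (n%:R / t) 1) => x1.
    by rewrite (ger1_powR (r := rho)) ?x0 ?orbT.
  by rewrite -{1}(powRr0 (n%:R / t)) ler_powR // ltW.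
apply: (@le_trans _ _ (p u * (A / p u `^ a / t) `^ rho)).
  apply: ler_wpM2l => //; apply: (le_trans minx); apply: ge0_ler_powR => //.
  - by rewrite nnegrE ltW.
  - by rewrite nnegrE !divr_ge0 // ltW.
  - by rewrite ler_pM2r ?invr_gt0.
rewrite le_eqVlt; apply/orP; left; apply/eqP.
rewrite !powRM ?divr_ge0 ?invr_ge0 ?(ltW pa0) ?(ltW t0) //.
have pw x : 0 < x -> x^-1 `^ rho = x `^ (- rho).
  by move=> xp; rewrite -powR_inv1 ?ltW // -powRrM mulN1r.
rewrite !pw // -powRrM.
(* [a = 1 - a * rho], because [a] is the inverse of [1 + rho]. *)
have -> : p u `^ a = p u * p u `^ (a * - rho).
  rewrite -{2}(powRr1 (p0 u)) -powRD; last by rewrite pu0 implybT.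
  by congr (_ `^ _); rewrite /a; field.
by ring.
Qed.

End Gallager.

(** * Tilted distributions *)

Section Tilting.
Context {R : realType} {Y Z : finType}.
Variable Q : Y * Z -> R.
Hypothesis Q_dist : isDist Q.
Implicit Types (rho : R) (s : Y) (u : Z).

Let Q0 x : 0 <= Q x. Proof. by case: Q_dist. Qed.

(** The power [Q ^ (1 / (1 + rho))], written with [expR] and [ln] to make continuity in [rho]
    direct. The sums below run over the support of [Q], which keeps out the default value of
    [ln 0]. *)
Definition tiltw rho x : R := expR (ln (Q x) / (1 + rho)).
Definition tiltA rho s : R := \sum_(u | 0 < Q (s, u)) tiltw rho (s, u).
Definition tiltsupp s : bool := [exists u, 0 < Q (s, u)].
Definition tiltG rho : R := \sum_(s | tiltsupp s) expR ((1 + rho) * ln (tiltA rho s)).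
(** For [rho >= 0], the minimizer of the divergence from [Q] minus [rho] times the conditional
    entropy: given [s] it is proportional to [tiltw], and its marginal is proportional to
    [tiltA ^ (1 + rho)]. *)
Definition tilt rho (x : Y * Z) : R :=
  if 0 < Q x then tiltw rho x * expR (rho * ln (tiltA rho x.1)) / tiltG rho else 0.
(** On the support of [Q], the logarithm of the conditional probability of [u] given [s] under
    [tilt rho]. *)
Definition tiltlog rho (x : Y * Z) : R := ln (Q x) / (1 + rho) - ln (tiltA rho x.1).

Lemma tiltA_gt0 rho s : tiltsupp s -> 0 < tiltA rho s.
Proof.
move=> /existsP [u su]; rewrite /tiltA (bigD1 u) //= ltr_wpDr ?expR_gt0 //.
by rewrite sumr_ge0 // => v _; exact: expR_ge0.
Qed.

Lemma tiltsuppE x : 0 < Q x -> tiltsupp x.1.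
Proof. by case: x => s u su; apply/existsP; exists u. Qed.

Lemma Q_gt0_ex : exists x, 0 < Q x.
Proof.
apply/existsP; apply: contraT; rewrite negb_exists => /forallP H.
have [_] := Q_dist; rewrite big1 => [/eqP|x _]; first by rewrite eq_sym oner_eq0.
by apply/eqP; rewrite eq_le Q0 andbT leNgt H.
Qed.

Lemma tiltG_gt0 rho : 0 < tiltG rho.
Proof.
have [x /tiltsuppE xs] := Q_gt0_ex; rewrite /tiltG (bigD1 x.1) //= ltr_wpDr ?expR_gt0 //.
by rewrite sumr_ge0 // => v _; exact: expR_ge0.
Qed.

Lemma tilt_gt0 rho x : (0 < tilt rho x) = (0 < Q x).
Proof.
rewrite /tilt; case: ifP => _; last by rewrite ltxx.
by rewrite divr_gt0 ?tiltG_gt0 // mulr_gt0 ?expR_gt0.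
Qed.

Lemma tilt_ge0 rho x : 0 <= tilt rho x.
Proof.
rewrite /tilt; case: ifP => _ //.
by rewrite divr_ge0 ?(ltW (tiltG_gt0 _)) // mulr_ge0 ?expR_ge0.
Qed.

Lemma marg_tilt rho s :
  marg (tilt rho) s = if tiltsupp s then expR ((1 + rho) * ln (tiltA rho s)) / tiltG rho else 0.
Proof.
rewrite /marg /tilt -big_mkcond /=; case: ifPn => [ss|].
  rewrite -mulr_suml -mulr_suml -/(tiltA rho s); congr (_ / _).
  by rewrite mulrDl mul1r expRD lnK // posrE tiltA_gt0.
rewrite negb_exists => /forallP ns; apply: big1 => u su.
by have := ns u; rewrite su.
Qed.

Lemma tilt_dist rho : isDist (tilt rho).
Proof.
split=> [x|]; first exact: tilt_ge0.
transitivity (\sum_s marg (tilt rho) s).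
  by rewrite /marg pair_bigA; apply: eq_bigr => -[].
under eq_bigr => s _ do rewrite marg_tilt.
by rewrite -big_mkcond -mulr_suml divff // gt_eqF // tiltG_gt0.
Qed.

Lemma marg_tilt_gt0 rho x : 0 < Q x -> 0 < marg (tilt rho) x.1.
Proof. by move=> /tiltsuppE xs; rewrite marg_tilt xs divr_gt0 ?expR_gt0 ?tiltG_gt0. Qed.

Lemma condW_tilt rho x : 0 < Q x -> condW (tilt rho) x.1 x.2 = expR (tiltlog rho x).
Proof.
move=> Qx; have xs := tiltsuppE _ Qx.
rewrite /condW marg_tilt xs -surjective_pairing /tilt Qx /tiltlog expRD expRN lnK ?posrE ?tiltA_gt0 //.
rewrite mulrDl mul1r expRD lnK ?posrE ?tiltA_gt0 // -/(tiltw rho x).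
field.
by rewrite (gt_eqF (tiltG_gt0 _)) ?(gt_eqF (expR_gt0 _)) ?(gt_eqF (tiltA_gt0 _ _ xs)).
Qed.

Lemma Hcond_tilt d rho :
  Hcond d (condW (tilt rho)) (marg (tilt rho)) =
  - ((\sum_(x | 0 < Q x) tilt rho x * tiltlog rho x) / ln d%:R).
Proof.
rewrite /Hcond; congr (- _); rewrite mulr_suml.
rewrite (eq_bigr (fun s => \sum_(u | 0 < Q (s, u)) tilt rho (s, u) * tiltlog rho (s, u) / ln d%:R)).
  rewrite pair_big_dep /=; apply: eq_big => -[s u] //=.
  apply/idP/idP => [/andP[]//|Qx]; rewrite Qx andbT.
  exact: (marg_tilt_gt0 rho (s, u)).
move=> s ms; apply: eq_big => [u|u].
  rewrite /condW; apply/idP/idP => [|Qx]; last by rewrite divr_gt0 // tilt_gt0.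
  by rewrite pmulr_lgt0 ?invr_gt0 // tilt_gt0.
move=> Wu; have Qx : 0 < Q (s, u).
  by move: Wu; rewrite /condW pmulr_lgt0 ?invr_gt0 // tilt_gt0.
have WE := condW_tilt rho (s, u) Qx; rewrite /= in WE.
rewrite /logd {2}WE expRK -[RHS]mulrA; congr (_ * _).
by rewrite /condW mulrC divfK // gt_eqF.
Qed.

(** On the support, [ln (tilt rho x / Q x) = - rho * tiltlog rho x - ln (tiltG rho)]; the divergence
    is thus [rho] times the conditional entropy minus the logarithm of [tiltG]. *)
Lemma KLdiv_tilt d rho : 0 <= rho ->
  KLdiv d (tilt rho) Q =
  ((rho * (- (\sum_(x | 0 < Q x) tilt rho x * tiltlog rho x)) - ln (tiltG rho)) / ln d%:R)%:E.
Proof.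
move=> r0; rewrite /KLdiv ifF; last first.
  apply/negbTE; rewrite negb_exists; apply/forallP => x; rewrite tilt_gt0 negb_and.
  by case: ltP => //= Qx; rewrite gt_eqF.
congr EFin; rewrite (eq_bigl (fun x => 0 < Q x)) => [|x]; last exact: tilt_gt0.
have sum1 : \sum_(x | 0 < Q x) tilt rho x = 1.
  have [_ <-] := tilt_dist rho; rewrite [RHS](bigID (fun x => 0 < Q x)) /=.
  rewrite [X in _ = _ + X]big1 ?addr0 // => x /negbTE Qx.
  by rewrite /tilt Qx.
rewrite -[X in _ - X]mul1r -[X in X * ln (tiltG _)]sum1 mulr_suml mulrN -mulNr mulr_sumr -sumrB mulr_suml.
apply: eq_bigr => x Qx; rewrite /logd mulrA; congr (_ / _).
have A0 := tiltA_gt0 rho _ (tiltsuppE _ Qx).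
have -> : ln (tilt rho x / Q x) =
    ln (Q x) / (1 + rho) + rho * ln (tiltA rho x.1) - ln (tiltG rho) - ln (Q x).
  rewrite /tilt Qx !ln_div ?posrE ?mulr_gt0 ?invr_gt0 ?expR_gt0 ?tiltG_gt0 //.
  by rewrite lnM ?posrE ?expR_gt0 // !expRK.
by rewrite /tiltlog; field; lra.
Qed.

Lemma gallager_tilt rho : 0 <= rho -> gallager (fun s u => Q (s, u)) rho = tiltG rho.
Proof.
move=> r0; have rr0 : 1 + rho != 0 by lra.
rewrite /gallager /tiltG [RHS]big_mkcond; apply: eq_bigr => s _.
have -> : \sum_u Q (s, u) `^ (1 + rho)^-1 = tiltA rho s.
  rewrite /tiltA [RHS]big_mkcond; apply: eq_bigr => u _.
  rewrite /tiltw; case: ltgtP (Q0 (s, u)) => // [Qx|<-] _.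
    by rewrite /powR gt_eqF // mulrC.
  by rewrite powR0 // invr_eq0.
case: ifPn => [/(tiltA_gt0 rho) A0|]; first by rewrite /powR gt_eqF.
rewrite negb_exists => /forallP ns.
rewrite /tiltA big_pred0 => [|u]; last exact/negbTE/ns.
by rewrite powR0.
Qed.

Local Open Scope classical_set_scope.

(** Up to sign and unit of the logarithm, this is continuity in [rho] of the conditional entropy of
    [tilt rho], as the intermediate value theorem demands. *)
Lemma cvg_tiltlog_sum (r : R) : 0 <= r ->
  (\sum_(x | 0 < Q x) tilt y x * tiltlog y x) @[y --> r] -->
   \sum_(x | 0 < Q x) tilt r x * tiltlog r x.
Proof.
move=> r0; have rr0 : 1 + r != 0 by lra.
have cD : (1 + y) @[y --> r] --> 1 + r by apply: cvgD; [exact: cvg_cst|exact: cvg_id].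
have cV : (1 + y)^-1 @[y --> r] --> (1 + r)^-1 by exact: cvgV.
have cexp (f : R -> R) : f y @[y --> r] --> f r -> expR (f y) @[y --> r] --> expR (f r).
  by move=> fr; apply: continuous_cvg => //; exact: continuous_expR.
have cln (f : R -> R) : 0 < f r -> f y @[y --> r] --> f r -> ln (f y) @[y --> r] --> ln (f r).
  by move=> f0 fr; apply: continuous_cvg => //; exact: continuous_ln.
have csum (I : finType) (P : pred I) (f : I -> R -> R) :
    (forall i, P i -> f i x @[x --> r] --> f i r) ->
    (\sum_(i | P i) f i x) @[x --> r] --> \sum_(i | P i) f i r.
  by move=> H; apply: cvg_big => //; exact: add_continuous.
have cq x : ln (Q x) / (1 + y) @[y --> r] --> ln (Q x) / (1 + r).
  by apply: cvgM => //; exact: cvg_cst.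
have cw x : tiltw y x @[y --> r] --> tiltw r x by exact: cexp.
have cA s : tiltA y s @[y --> r] --> tiltA r s by apply: csum => u _; exact: cw.
have clA s : tiltsupp s -> ln (tiltA y s) @[y --> r] --> ln (tiltA r s).
  by move=> ss; apply: cln => //; exact: tiltA_gt0.
have cG : tiltG y @[y --> r] --> tiltG r.
  by apply: csum => s ss; apply: cexp; apply: cvgM => //; exact: clA.
apply: csum => x Qx; have xs := tiltsuppE _ Qx.
apply: cvgM; last by apply: cvgB => //; exact: clA.
rewrite /tilt Qx; apply: cvgM; last by apply: cvgV => //; rewrite gt_eqF ?tiltG_gt0.
by apply: cvgM => //; apply: cexp; apply: cvgM; [exact: cvg_id|exact: clA].
Qed.

(* [D(tilt rho || Q) + rho (c - H(tilt rho)) = rho c - log (tiltG rho)], and by the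
   intermediate value theorem [rho] can be chosen so that [rho (c - H)] is the
   positive part of [c - H]. *)
Lemma Enk_le_gallager (d k : nat) (Rt : R) : (1 < d)%N ->
  let c := k%:R - k%:R * Rt in
  (Enk d k Rt Q <= 0)%E \/
  0 <= c /\ exists2 rho, 0 <= rho <= 1 &
    (Enk d k Rt Q <= (rho * c - logd d (gallager (fun s u => Q (s, u)) rho))%:E)%E.
Proof.
move=> d1 c; have L0 : 0 < ln (d%:R : R) by rewrite ln_gt0 // ltr1n.
pose H rho := Hcond d (condW (tilt rho)) (marg (tilt rho)).
(* Any distribution bounds the infimum from above; [tilt rho] is inserted. *)
have EnkE rho : 0 <= rho -> (Enk d k Rt Q <=
    (rho * H rho - logd d (gallager (fun s u => Q (s, u)) rho) + posp (c - H rho))%:E)%E.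
  move=> r0; apply: ereal_inf_lbound; exists (tilt rho); split; first exact: tilt_dist.
  rewrite KLdiv_tilt // -/(H rho) -/c -EFinD; congr ((_ + _)%:E).
  rewrite gallager_tilt // /H Hcond_tilt /logd mulrBl; congr (_ - _).
  by rewrite -mulrA mulNr.
have HE rho : H rho = - ((\sum_(x | 0 < Q x) tilt rho x * tiltlog rho x) / ln d%:R).
  exact: Hcond_tilt.
clearbody H c.
(* Nonnegativity of the entropy yields [0 <= c] in the second alternative, which later ensures that
   the required code dimension is available. *)
have H_ge0 : 0 <= H 0.
  rewrite HE oppr_ge0 pmulr_lle0 ?invr_gt0 //; apply: sumr_le0 => x Qx.
  rewrite pmulr_rle0 ?tilt_gt0 // -[tiltlog _ _]expRK -condW_tilt //.
  apply: ln_le0; rewrite ler_pdivrMr ?marg_tilt_gt0 // mul1r /marg (bigD1 x.2) //= lerDl.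
  by rewrite sumr_ge0 // => u _; exact: tilt_ge0.
(* At [rho = 0] the tilt is [Q] itself: the divergence is 0, and the positive part is 0 as well when
   [c <= H 0]. *)
have [c0|c0] := leP c (H 0).
  left; apply: le_trans (EnkE 0 (lexx _)) _; rewrite lee_fin mul0r add0r.
  have -> : gallager (fun s u => Q (s, u)) 0 = 1.
    have [_ <-] := Q_dist; rewrite /gallager addr0 invr1.
    rewrite [RHS](eq_bigr (fun x => Q (x.1, x.2))) => [|[]//].
    rewrite -(pair_bigA _ (fun s u => Q (s, u))) /=.
    apply: eq_bigr => s _; rewrite powRr1.
      by apply: eq_bigr => u _; rewrite powRr1.
    by rewrite sumr_ge0 // => u _; rewrite powRr1.
  by rewrite /logd ln1 mul0r oppr0 add0r /posp ge_max lexx andbT subr_le0.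
right; split; first exact: ltW (le_lt_trans H_ge0 c0).
(* When [c] is at least [H 1], the end point [rho = 1] works, since the positive part then equals
   [c - H 1]. *)
have [c1|c1] := leP (H 1) c.
  exists 1; first by rewrite ler01 lexx.
  apply: le_trans (EnkE 1 ler01) _; rewrite lee_fin /posp max_l ?subr_ge0 //.
  by rewrite !mul1r addrC addrA subrK.
have [rho rI rE] : exists2 rho, rho \in `[0, 1]%R & H rho = c.
  apply: IVT => //; last first.
    have Hle := ltW (lt_trans c0 c1).
    by rewrite (min_idPl Hle) (max_idPr Hle) (ltW c0) (ltW c1).
  apply: continuous_in_subspaceT => x.
  rewrite inE /= in_itv /= => /andP[x0 _].
  rewrite /continuous_at HE; under eq_cvg do rewrite HE.
  by apply: cvgN; apply: cvgM; [exact: cvg_tiltlog_sum|exact: cvg_cst].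
move: rI; rewrite in_itv /= => /andP[r0 r1].
exists rho; first by rewrite r0.
apply: le_trans (EnkE rho r0) _; rewrite lee_fin /posp rE subrr max_l //.
by rewrite addr0.
Qed.

End Tilting.

(** * Symplectic forms on blocks *)

HB.instance Definition _ (I : finType) (T : finZmodType) := GRing.Zmodule.on {ffun I -> T}.
HB.instance Definition _ (F : nzRingType) (I : finType) (T : finLmodType F) :=
  GRing.Lmodule.on {ffun I -> T}.
HB.instance Definition _ (T U : finZmodType) := GRing.Zmodule.on (T * U)%type.

Section SymplecticForm.
Context {F : fieldType} {n : nat}.
Implicit Types x y z : 'rV[F]_(n * 2).

Lemma ucoordD x y i : ucoord (x + y) i = ucoord x i + ucoord y i.
Proof. by rewrite /ucoord linearD mxE. Qed.

Lemma vcoordD x y i : vcoord (x + y) i = vcoord x i + vcoord y i.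
Proof. by rewrite /vcoord linearD mxE. Qed.

Lemma ucoordZ a x i : ucoord (a *: x) i = a * ucoord x i.
Proof. by rewrite /ucoord linearZ mxE. Qed.

Lemma vcoordZ a x i : vcoord (a *: x) i = a * vcoord x i.
Proof. by rewrite /vcoord linearZ mxE. Qed.

Lemma symplDl x y z : sympl (x + y) z = sympl x z + sympl y z.
Proof.
rewrite /sympl -big_split; apply: eq_bigr => i _.
by rewrite ucoordD vcoordD /=; ring.
Qed.

Lemma symplDr x y z : sympl z (x + y) = sympl z x + sympl z y.
Proof.
rewrite /sympl -big_split; apply: eq_bigr => i _.
by rewrite ucoordD vcoordD /=; ring.
Qed.

Lemma symplZl a x y : sympl (a *: x) y = a * sympl x y.
Proof.
rewrite /sympl mulr_sumr; apply: eq_bigr => i _.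
by rewrite ucoordZ vcoordZ /=; ring.
Qed.

Lemma symplZr a x y : sympl x (a *: y) = a * sympl x y.
Proof.
rewrite /sympl mulr_sumr; apply: eq_bigr => i _.
by rewrite ucoordZ vcoordZ /=; ring.
Qed.

Lemma sympl_alt x : sympl x x = 0.
Proof. by rewrite /sympl big1 // => i _; rewrite mulrC subrr. Qed.

Lemma sympl0l x : sympl 0 x = 0.
Proof. by rewrite -(scale0r 0) symplZl mul0r. Qed.

Lemma symplC x y : sympl x y = - sympl y x.
Proof. by rewrite /sympl -sumrN; apply: eq_bigr => i _; ring. Qed.

Lemma sympl0r x : sympl x 0 = 0.
Proof. by rewrite symplC sympl0l oppr0. Qed.

Lemma sympl_suml (I : finType) (f : I -> 'rV[F]_(n * 2)) y :
  sympl (\sum_i f i) y = \sum_i sympl (f i) y.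
Proof.
by apply: (big_morph (fun x => sympl x y)); [move=> ? ?; exact: symplDl|exact: sympl0l].
Qed.

Lemma sympl_sumr (I : finType) (f : I -> 'rV[F]_(n * 2)) y :
  sympl y (\sum_i f i) = \sum_i sympl y (f i).
Proof.
by apply: (big_morph (fun x => sympl y x)); [move=> ? ?; exact: symplDr|exact: sympl0r].
Qed.

Definition uvec (f g : 'I_n -> F) : 'rV[F]_(n * 2) :=
  mxvec (\matrix_(i, c) if c == ord0 then f i else g i).

Lemma ucoord_uvec f g i : ucoord (uvec f g) i = f i.
Proof. by rewrite /ucoord mxvecK mxE eqxx. Qed.

Lemma vcoord_uvec f g i : vcoord (uvec f g) i = g i.
Proof. by rewrite /vcoord mxvecK mxE. Qed.

Lemma uvcoord_inj x y : (forall i, ucoord x i = ucoord y i) ->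
  (forall i, vcoord x i = vcoord y i) -> x = y.
Proof.
move=> Hu Hv; apply: (can_inj vec_mxK); apply/matrixP => i c.
case: (unliftP ord0 c) => [c' ->|->]; last exact: Hu.
have -> : lift ord0 c' = ord_max by apply: val_inj; rewrite /= (ord1 c').
exact: Hv.
Qed.

Lemma sympl_nondeg x : x != 0 -> exists y, sympl y x != 0.
Proof.
move=> x0; apply: contrapT => H; move/negP: x0; apply; apply/eqP.
have H0 y : sympl y x = 0.
  by apply/eqP; apply: contraT => yx; case: H; exists y.
have u0 i : ucoord (0 : 'rV[F]_(n * 2)) i = 0 by rewrite -(scale0r 0) ucoordZ mul0r.
have v0 i : vcoord (0 : 'rV[F]_(n * 2)) i = 0 by rewrite -(scale0r 0) vcoordZ mul0r.
apply: uvcoord_inj => i; rewrite ?u0 ?v0.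
  have := H0 (uvec (fun=> 0) (fun j => (j == i)%:R)).
  rewrite /sympl (bigD1 i) //= big1 => [|j /negPf ji].
    by rewrite ucoord_uvec vcoord_uvec eqxx addr0 mul0r mul1r sub0r => /eqP; rewrite oppr_eq0 => /eqP.
  by rewrite ucoord_uvec vcoord_uvec ji !mul0r subr0.
have := H0 (uvec (fun j => (j == i)%:R) (fun=> 0)).
rewrite /sympl (bigD1 i) //= big1 => [|j /negPf ji].
  by rewrite ucoord_uvec vcoord_uvec eqxx addr0 mul0r mul1r subr0.
by rewrite ucoord_uvec vcoord_uvec ji !mul0r subr0.
Qed.

End SymplecticForm.

Section BlockForms.
Context {F : finFieldType} {N : nat}.

Definition symplN {m} (x y : {ffun 'I_N -> 'rV[F]_(m * 2)}) : F := \sum_b sympl (x b) (y b).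

Definition dotN {m} (x y : {ffun 'I_N -> 'rV[F]_m}) : F := \sum_b \sum_j x b 0 j * y b 0 j.

Lemma symplNDl m (x y z : {ffun 'I_N -> 'rV[F]_(m * 2)}) :
  symplN (x + y) z = symplN x z + symplN y z.
Proof. by rewrite /symplN -big_split; apply: eq_bigr => b _; rewrite ffunE symplDl. Qed.

Lemma symplNDr m (x y z : {ffun 'I_N -> 'rV[F]_(m * 2)}) :
  symplN z (x + y) = symplN z x + symplN z y.
Proof. by rewrite /symplN -big_split; apply: eq_bigr => b _; rewrite ffunE symplDr. Qed.

Lemma symplNZl m a (x y : {ffun 'I_N -> 'rV[F]_(m * 2)}) :
  symplN (a *: x) y = a * symplN x y.
Proof. by rewrite /symplN mulr_sumr; apply: eq_bigr => b _; rewrite ffunE symplZl. Qed.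

Lemma symplNZr m a (x y : {ffun 'I_N -> 'rV[F]_(m * 2)}) :
  symplN x (a *: y) = a * symplN x y.
Proof. by rewrite /symplN mulr_sumr; apply: eq_bigr => b _; rewrite ffunE symplZr. Qed.

Lemma symplN_alt m (x : {ffun 'I_N -> 'rV[F]_(m * 2)}) : symplN x x = 0.
Proof. by rewrite /symplN big1 // => b _; rewrite sympl_alt. Qed.

Lemma ffun_neq0 (T : zmodType) (x : {ffun 'I_N -> T}) : x != 0 -> exists b, x b != 0.
Proof.
move=> x0; apply/existsP; apply: contraNT x0; rewrite negb_exists => /forallP H.
by apply/eqP/ffunP => b; rewrite ffunE; apply/eqP; move: (H b); rewrite negbK.
Qed.

Lemma symplN_nondeg m (x : {ffun 'I_N -> 'rV[F]_(m * 2)}) :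
  x != 0 -> exists y, symplN y x != 0.
Proof.
move=> /ffun_neq0 [b /sympl_nondeg [y yx]]; exists [ffun b' => if b' == b then y else 0].
rewrite /symplN (bigD1 b) //= ffunE eqxx big1 ?addr0 // => b' /negPf bb'.
by rewrite ffunE bb' sympl0l.
Qed.

Lemma dotNDl m (x y z : {ffun 'I_N -> 'rV[F]_m}) : dotN (x + y) z = dotN x z + dotN y z.
Proof.
rewrite /dotN -big_split; apply: eq_bigr => b _; rewrite -big_split.
by apply: eq_bigr => j _; rewrite ffunE mxE mulrDl.
Qed.

Lemma dotNC m (x y : {ffun 'I_N -> 'rV[F]_m}) : dotN x y = dotN y x.
Proof. by apply: eq_bigr => b _; apply: eq_bigr => j _; rewrite mulrC. Qed.

Lemma dotNDr m (x y z : {ffun 'I_N -> 'rV[F]_m}) : dotN z (x + y) = dotN z x + dotN z y.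
Proof. by rewrite dotNC dotNDl !(dotNC _ z). Qed.

Lemma dotN_nondeg m (x : {ffun 'I_N -> 'rV[F]_m}) : x != 0 -> exists y, dotN y x != 0.
Proof.
move=> /ffun_neq0 [b xb].
have [j xj] : exists j, x b 0 j != 0.
  apply/existsP; apply: contraNT xb; rewrite negb_exists => /forallP H.
  by apply/eqP/rowP => j; rewrite mxE; apply/eqP; move: (H j); rewrite negbK.
exists [ffun b' => if b' == b then delta_mx 0 j else 0].
rewrite /dotN (bigD1 b) //= [X in _ + X]big1 => [|b' /negPf bb']; last first.
  by rewrite big1 // => i _; rewrite ffunE bb' mxE mul0r.
rewrite (bigD1 j) //= [X in _ + X + _]big1 => [|i /negPf ij]; last by rewrite ffunE eqxx mxE ij andbF mul0r.
by rewrite ffunE eqxx mxE !eqxx mul1r !addr0.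
Qed.

(** The symplectic form in the coordinates [((w, s), u)]: [w] and [s] are conjugate to each other,
    while [u] carries a symplectic form of its own. *)
Definition errform {m l} (x y : {ffun 'I_N -> 'rV[F]_m} * {ffun 'I_N -> 'rV[F]_m} *
    {ffun 'I_N -> 'rV[F]_(l * 2)}) : F :=
  dotN x.1.1 y.1.2 - dotN x.1.2 y.1.1 + symplN x.2 y.2.

Context {m l : nat}.
Local Notation V := ({ffun 'I_N -> 'rV[F]_m} * {ffun 'I_N -> 'rV[F]_m} *
    {ffun 'I_N -> 'rV[F]_(l * 2)})%type.
Implicit Types x y z : V.

Lemma errformDl x y z : errform (x + y) z = errform x z + errform y z.
Proof. by rewrite /errform /= !dotNDl symplNDl; ring. Qed.

Lemma errformDr x y z : errform z (x + y) = errform z x + errform z y.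
Proof. by rewrite /errform /= !dotNDr symplNDr; ring. Qed.

Lemma dotN0l p (x : {ffun 'I_N -> 'rV[F]_p}) : dotN 0 x = 0.
Proof. by apply: (@addrI _ (dotN 0 x)); rewrite -dotNDl !addr0. Qed.

Lemma symplN0l p (x : {ffun 'I_N -> 'rV[F]_(p * 2)}) : symplN 0 x = 0.
Proof. by rewrite -(scale0r 0) symplNZl mul0r. Qed.

Lemma errform_nondeg x : x != 0 -> exists y, errform y x != 0.
Proof.
case: x => -[w s] u; rewrite /errform /=.
have [->|/symplN_nondeg [u' uu'] _] := eqVneq u 0; last first.
  by exists ((0, 0), u'); rewrite /= !dotN0l subr0 add0r.
have [->|/dotN_nondeg [w' ww'] _] := eqVneq s 0; last first.
  by exists ((w', 0), 0); rewrite /= dotN0l symplN0l subr0 addr0.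
have [->|/dotN_nondeg [s' ss'] _] := eqVneq w 0; last first.
  by exists ((0, s'), 0); rewrite /= dotN0l symplN0l sub0r addr0 oppr_eq0.
by rewrite eqxx.
Qed.

End BlockForms.

(** * Symplectic coordinates of an error *)

Section SplitIndex.
Context {n k : nat} (Hkn : (k <= n)%N).

Definition ordL (j : 'I_(n - k)) : 'I_n := cast_ord (subnK Hkn) (lshift k j).
Definition ordR (j : 'I_k) : 'I_n := cast_ord (subnK Hkn) (rshift (n - k) j).

Definition glue {T} (f : 'I_(n - k) -> T) (f' : 'I_k -> T) (i : 'I_n) : T :=
  match split (cast_ord (esym (subnK Hkn)) i) with inl j => f j | inr j => f' j end.

Lemma glueL T (f : 'I_(n - k) -> T) f' j : glue f f' (ordL j) = f j.
Proof. by rewrite /glue /ordL cast_ordK -[lshift k j]/(unsplit (inl j)) unsplitK. Qed.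

Lemma glueR T (f : 'I_(n - k) -> T) f' j : glue f f' (ordR j) = f' j.
Proof. by rewrite /glue /ordR cast_ordK -[rshift _ j]/(unsplit (inr j)) unsplitK. Qed.

Lemma ordLR_ind (P : 'I_n -> Prop) :
  (forall j, P (ordL j)) -> (forall j, P (ordR j)) -> forall i, P i.
Proof.
move=> HL HR i; rewrite -(cast_ordKV (subnK Hkn) i) -[cast_ord (esym _) i]splitK.
by case: (split _) => j; [exact: HL|exact: HR].
Qed.

Lemma sum_ordLR (G : zmodType) (f : 'I_n -> G) :
  \sum_i f i = \sum_j f (ordL j) + \sum_j f (ordR j).
Proof.
rewrite (reindex (cast_ord (subnK Hkn))) /=; first by rewrite big_split_ord.
by exists (cast_ord (esym (subnK Hkn))) => i _; rewrite ?cast_ordK ?cast_ordKV.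
Qed.

End SplitIndex.

Section SymplecticCoordinates.
Context {F : finFieldType} {n k : nat} (Hkn : (k <= n)%N).
Variables g h : 'I_n -> 'rV[F]_(n * 2).
Hypothesis Hgh : forall i j : 'I_n, sympl (g i) (h j) = (i == j)%:R.
Hypothesis Hgg : forall i j : 'I_n, sympl (g i) (g j) = 0.
Hypothesis Hhh : forall i j : 'I_n, sympl (h i) (h j) = 0.

Definition ghcomb (w z : 'I_n -> F) : 'rV[F]_(n * 2) := \sum_i (w i *: g i + z i *: h i).

Lemma sympl_g_ghcomb w z i : sympl (g i) (ghcomb w z) = z i.
Proof.
rewrite /ghcomb sympl_sumr (bigD1 i) //= big1 => [|j /negPf ji].
  by rewrite symplDr !symplZr Hgg Hgh eqxx mulr0 add0r mulr1 addr0.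
by rewrite symplDr !symplZr Hgg Hgh eq_sym ji !mulr0 addr0.
Qed.

Lemma sympl_ghcomb_h w z i : sympl (ghcomb w z) (h i) = w i.
Proof.
rewrite /ghcomb sympl_suml (bigD1 i) //= big1 => [|j /negPf ji].
  by rewrite symplDl !symplZl Hhh Hgh eqxx mulr0 !addr0 mulr1.
by rewrite symplDl !symplZl Hhh Hgh ji !mulr0 addr0.
Qed.

Lemma sympl_ghcomb w z w' z' :
  sympl (ghcomb w z) (ghcomb w' z') = \sum_i (w i * z' i - z i * w' i).
Proof.
rewrite {1}/ghcomb sympl_suml; apply: eq_bigr => i _.
rewrite symplDl !symplZl sympl_g_ghcomb [sympl (h i) _]symplC sympl_ghcomb_h.
by rewrite mulrN.
Qed.

Lemma eq_ghcomb w z w' z' : w =1 w' -> z =1 z' -> ghcomb w z = ghcomb w' z'.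
Proof. by move=> ww' zz'; apply: eq_bigr => i _; rewrite ww' zz'. Qed.

(** [w] gives the component in the span of the first [n - k] vectors [g], [s] the coefficients of
    their partners [h], and [u] the coordinates along the remaining [k] hyperbolic pairs. *)
Definition errblock (w s : 'rV[F]_(n - k)) (u : 'rV[F]_(k * 2)) : 'rV[F]_(n * 2) :=
  ghcomb (glue Hkn (fun j => w 0 j) (ucoord u)) (glue Hkn (fun j => s 0 j) (vcoord u)).

Lemma errblockD w s u w' s' u' :
  errblock (w + w') (s + s') (u + u') = errblock w s u + errblock w' s' u'.
Proof.
rewrite /errblock /ghcomb -big_split; apply: eq_bigr => i _ /=.
elim/(ordLR_ind Hkn): i => j; rewrite ?glueL ?glueR ?mxE ?ucoordD ?vcoordD !scalerDl;
  by rewrite !addrA; congr (_ + _); rewrite -!addrA; congr (_ + _); exact: addrC.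
Qed.

Lemma sympl_errblock w s u w' s' u' :
  sympl (errblock w s u) (errblock w' s' u') =
  \sum_j w 0 j * s' 0 j - \sum_j s 0 j * w' 0 j + sympl u u'.
Proof.
rewrite sympl_ghcomb (sum_ordLR Hkn) -sumrB; congr (_ + _).
  by apply: eq_bigr => j _; rewrite !glueL.
by apply: eq_bigr => j _; rewrite !glueR.
Qed.

End SymplecticCoordinates.

(** The constraints in [PL] leave free only the coefficients of the first [n - k] vectors [g];
    pairing with [h] recovers them, so the sum can be reindexed by [w]. *)
Lemma PLE {R : realType} (d n k : nat) (Hkn : (k <= n)%N) (P : 'F_d * 'F_d -> R)
    (g h : 'I_n -> 'rV['F_d]_(n * 2))
    (Hgh : forall i j : 'I_n, sympl (g i) (h j) = (i == j)%:R)
    (Hhh : forall i j : 'I_n, sympl (h i) (h j) = 0) s u :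
  PL d n k P g h (s, u) = \sum_w Pvec d n P (errblock Hkn g h w s u).
Proof.
pose wof (x : 'rV['F_d]_(n * 2)) : 'rV['F_d]_(n - k) := \row_j sympl x (h (ordL Hkn j)).
have wofK w : wof (errblock Hkn g h w s u) = w.
  by apply/rowP => j; rewrite mxE (sympl_ghcomb_h g h Hgh Hhh) glueL.
rewrite /PL (reindex_onto (fun w => errblock Hkn g h w s u) wof) /=.
  apply: eq_bigl => w; rewrite wofK eqxx andbT.
  apply/existsP; exists [ffun i => glue Hkn (fun j => w 0 j) (ucoord u) i].
  apply/existsP; exists [ffun i => glue Hkn (fun j => s 0 j) (vcoord u) i].
  apply/and3P; split.
  - by apply/eqP/eq_bigr => i _; rewrite !ffunE.
  - apply/forallP => i; apply/forallP => j; apply/implyP => /eqP ij.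
    have -> : i = ordL Hkn j by apply: val_inj.
    by rewrite ffunE glueL.
  - apply/forallP => i; apply/forallP => j; apply/implyP => /eqP ij.
    have -> : i = ordR Hkn j by apply: val_inj.
    by rewrite !ffunE !glueR !eqxx.
move=> x /existsP [w /existsP [z /and3P[/eqP xE /forallP Hs /forallP Hu]]].
have HsE j : z (ordL Hkn j) = s 0 j.
  by apply/eqP; have /forallP/(_ j)/implyP := Hs (ordL Hkn j); apply.
have HuE j : w (ordR Hkn j) = ucoord u j /\ z (ordR Hkn j) = vcoord u j.
  by have /forallP/(_ j)/implyP := Hu (ordR Hkn j); rewrite eqxx => /(_ isT)/andP[/eqP ? /eqP ?].
have xE' : x = ghcomb g h w z by [].
rewrite [RHS]xE'; apply: eq_ghcomb => i; elim/(ordLR_ind Hkn): i => j;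
  rewrite ?glueL ?glueR ?HsE //; try by case: (HuE j).
by rewrite mxE xE' (sympl_ghcomb_h g h Hgh Hhh).
Qed.

Lemma sum_mxvec_index (N n : nat) (G : zmodType) (f : 'I_(N * n) -> G) :
  \sum_i f i = \sum_b \sum_j f (mxvec_index b j).
Proof. by rewrite pair_bigA (reindex _ (curry_mxvec_bij N n)); apply: eq_bigr => -[]. Qed.

Lemma prod_mxvec_index (N n : nat) (G : comNzRingType) (f : 'I_(N * n) -> G) :
  \prod_i f i = \prod_b \prod_j f (mxvec_index b j).
Proof. by rewrite pair_bigA (reindex _ (curry_mxvec_bij N n)); apply: eq_bigr => -[]. Qed.

Lemma addr_pair (G H : zmodType) (a b : G) (c e : H) : (a + b, c + e) = (a, c) + (b, e).
Proof. by []. Qed.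

(** * Blocks of length [n] laid end to end *)

Section Unblock.
Context {F : finFieldType} {n N : nat}.
Implicit Types X : 'I_N -> 'rV[F]_(n * 2).

Definition unblock X : {ffun 'I_(N * n) -> F * F} :=
  [ffun i => (mxvec (\matrix_(b, j) ucoord (X b) j) 0 i,
              mxvec (\matrix_(b, j) vcoord (X b) j) 0 i)].

Lemma unblockE X b j : unblock X (mxvec_index b j) = (ucoord (X b) j, vcoord (X b) j).
Proof. by rewrite ffunE !mxvecE !mxE. Qed.

Lemma unblockD X X' : unblock (fun b => X b + X' b) = unblock X + unblock X'.
Proof.
apply/ffunP => i; rewrite [RHS]ffunE; case/mxvec_indexP: i => b j.
by rewrite !unblockE ucoordD vcoordD addr_pair.
Qed.

Lemma unblock_form X X' :
  \sum_i ((unblock X i).1 * (unblock X' i).2 - (unblock X i).2 * (unblock X' i).1) =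
  \sum_b sympl (X b) (X' b).
Proof.
rewrite sum_mxvec_index; apply: eq_bigr => b _.
by apply: eq_bigr => j _; rewrite !unblockE.
Qed.

Lemma pauli_form0 (I : finType) (z : {ffun I -> F * F}) :
  \sum_i ((z i).1 * ((0 : {ffun I -> F * F}) i).2 - (z i).2 * ((0 : {ffun I -> F * F}) i).1) = 0.
Proof. by rewrite big1 // => i _; rewrite ffunE /= !mulr0 subr0. Qed.

Lemma eq_unblock X X' : X =1 X' -> unblock X = unblock X'.
Proof. by move/funext ->. Qed.

End Unblock.

Lemma Ppow_unblock {R : realType} (d n N : nat) (P : 'F_d * 'F_d -> R)
    (X : 'I_N -> 'rV['F_d]_(n * 2)) :
  Ppow d (N * n) P (unblock X) = \prod_b Pvec d n P (X b).
Proof.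
rewrite /Ppow prod_mxvec_index; apply: eq_bigr => b _; apply: eq_bigr => j _.
by rewrite unblockE.
Qed.

Section PhysicalError.
Context {d n k N : nat} (Hkn : (k <= n)%N).
Hypothesis d_prime : prime d.
Variables g h : 'I_n -> 'rV['F_d]_(n * 2).
Hypothesis Hgh : forall i j : 'I_n, sympl (g i) (h j) = (i == j)%:R.
Hypothesis Hgg : forall i j : 'I_n, sympl (g i) (g j) = 0.
Hypothesis Hhh : forall i j : 'I_n, sympl (h i) (h j) = 0.

Local Notation YN := {ffun 'I_N -> 'rV['F_d]_(n - k)}.
Local Notation ZN := {ffun 'I_N -> 'rV['F_d]_(k * 2)}.
Local Notation V := (YN * YN * ZN)%type.
Implicit Types v : V.

Definition verr v (b : 'I_N) := errblock Hkn g h (v.1.1 b) (v.1.2 b) (v.2 b).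

Definition physerr v : {ffun 'I_(N * n) -> 'F_d * 'F_d} := unblock (verr v).

Lemma physerrD v v' : physerr (v + v') = physerr v + physerr v'.
Proof.
rewrite /physerr -unblockD; apply: eq_unblock => b.
have addE (T : zmodType) (x y : {ffun 'I_N -> T}) : (x + y) b = x b + y b.
  by rewrite ffunE.
by rewrite /verr -errblockD -!addE.
Qed.

Lemma physerr_form v v' :
  \sum_i ((physerr v i).1 * (physerr v' i).2 - (physerr v i).2 * (physerr v' i).1) =
  errform v v'.
Proof.
rewrite unblock_form /errform /dotN /symplN -sumrB -big_split; apply: eq_bigr => b _ /=.
exact: sympl_errblock.
Qed.

(** An additive map that transports a nondegenerate form has trivial kernel. *)
Lemma physerr_inj : injective physerr.
Proof.
move=> v v' vv'; apply/eqP; rewrite -subr_eq0; apply: contraT => /errform_nondeg [y].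
have p0 : physerr 0 = 0.
  by apply: (@addrI _ (physerr 0)); rewrite -physerrD !addr0.
have -> : errform y (v - v') = 0; last by rewrite eqxx.
rewrite -physerr_form; have -> : physerr (v - v') = 0.
  by apply: (@addIr _ (physerr v')); rewrite -physerrD subrK add0r.
exact: pauli_form0.
Qed.

(** Injectivity and equal cardinals: both sides have dimension [2 N (n - k) + 2 N k = 2 N n]. *)
Lemma physerr_bij : bijective physerr.
Proof.
apply: inj_card_bij physerr_inj _.
rewrite !card_prod !card_ffun !card_ord !card_mx !mul1n card_prod !card_Fp //.
rewrite -!expnM -!expnD mulnn -expnM leq_exp2l ?prime_gt1 //.
have : (n = n - k + k)%N by lia.
by move: (n - k)%N => m ->; lia.
Qed.

Lemma Ppow_physerr {R : realType} (P : 'F_d * 'F_d -> R) v :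
  Ppow d (N * n) P (physerr v) = \prod_b Pvec d n P (verr v b).
Proof.
exact: Ppow_unblock.
Qed.

Lemma sum_Ppow_physerr {R : realType} (P : 'F_d * 'F_d -> R) (s : YN) (u : ZN) :
  \sum_w Ppow d (N * n) P (physerr ((w, s), u)) = \prod_b PL d n k P g h (s b, u b).
Proof.
under [RHS]eq_bigr => b _ do rewrite (PLE _ _ _ Hkn _ _ _ Hgh Hhh).
by rewrite bigA_distr_bigA; apply: eq_bigr => w _; rewrite Ppow_physerr.
Qed.

Lemma sum_Ppow {R : realType} (M : nat) (P : 'F_d * 'F_d -> R) : isDist P ->
  \sum_x Ppow d M P x = 1.
Proof.
move=> [_ P1]; transitivity (\prod_(i < M) \sum_a P a); first by rewrite bigA_distr_bigA.
by rewrite big1.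
Qed.

(** For events that ignore [w], summing it out leaves the product law of the pairs [(s, u)]. *)
Lemma sum_blocks_PL {R : realType} (P : 'F_d * 'F_d -> R) (f : YN -> ZN -> bool) :
  \sum_(v | f v.1.2 v.2) Ppow d (N * n) P (physerr v) =
  \sum_s \sum_(u | f s u) \prod_b PL d n k P g h (s b, u b).
Proof.
rewrite pair_big_dep /=.
rewrite [RHS](eq_bigr (fun x : YN * ZN => \sum_w Ppow d (N * n) P (physerr ((w, x.1), x.2)))); last first.
  by move=> [s u] _; rewrite sum_Ppow_physerr.
rewrite exchange_big pair_big_dep /=.
rewrite (reindex (fun y : YN * (YN * ZN) => ((y.1, y.2.1), y.2.2))) /=.
  by apply: eq_bigl => -[w [s u]].
by exists (fun v : V => (v.1.1, (v.1.2, v.2))) => [[w [s u]]|[[w s] u]].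
Qed.

End PhysicalError.

(** The total mass is the case of a single block and the event that always holds. *)
Lemma PL_dist {R : realType} (d n k : nat) (Hkn : (k <= n)%N) (d_prime : prime d)
    (P : 'F_d * 'F_d -> R) (HP : isDist P) (g h : 'I_n -> 'rV['F_d]_(n * 2))
    (Hgh : forall i j : 'I_n, sympl (g i) (h j) = (i == j)%:R)
    (Hgg : forall i j : 'I_n, sympl (g i) (g j) = 0)
    (Hhh : forall i j : 'I_n, sympl (h i) (h j) = 0) :
  isDist (PL d n k P g h).
Proof.
have [P0 P1] := HP; split=> [[s u]|].
  rewrite (PLE _ _ _ Hkn) // sumr_ge0 // => w _; exact: prodr_ge0.
have := sum_Ppow (1 * n) P HP.
rewrite (reindex _ (onW_bij _ (physerr_bij Hkn d_prime g h Hgh Hgg Hhh))) /=.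
rewrite (sum_blocks_PL Hkn g h Hgh Hhh P (fun _ _ => true)) => <-.
transitivity (\prod_(b < 1) \sum_s \sum_u PL d n k P g h (s, u)).
  by rewrite big_ord1 pair_bigA; apply: eq_bigr => -[].
rewrite bigA_distr_bigA; apply: eq_bigr => s _.
by rewrite bigA_distr_bigA.
Qed.

(** * Random concatenated codes *)

(** Take the vectors with all [v] coordinates zero, so that the form vanishes, and let the first [r]
    of the [N * k] coordinates [u] be free. *)
Lemma isotropic_subgroup {F : finFieldType} (N k r : nat) : (r <= N * k)%N ->
  exists T : pred {ffun 'I_N -> 'rV[F]_(k * 2)},
  [/\ 0 \in T, forall x y, x \in T -> y \in T -> x - y \in T,
      forall x y, x \in T -> y \in T -> symplN x y = 0 & #|T| = (#|F| ^ r)%N].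
Proof.
move=> rNk.
pose pad (f : {ffun 'I_r -> F}) (i : 'I_(N * k)) : F :=
  if insub (val i) is Some i' then f i' else 0.
pose emb f : {ffun 'I_N -> 'rV[F]_(k * 2)} :=
  [ffun b => uvec (fun j => pad f (mxvec_index b j)) (fun=> 0)].
have padB f f' i : pad (f - f') i = pad f i - pad f' i.
  by rewrite /pad; case: insub => [i'|]; rewrite ?ffunE ?subr0.
have embu f b j : ucoord (emb f b) j = pad f (mxvec_index b j) by rewrite ffunE ucoord_uvec.
have embv f b j : vcoord (emb f b) j = 0 by rewrite ffunE vcoord_uvec.
have embB f f' : emb (f - f') = emb f - emb f'.
  apply/ffunP => b; rewrite [RHS]ffunE [X in _ = _ + X]ffunE -scaleN1r.
  apply: uvcoord_inj => j; rewrite ?ucoordD ?ucoordZ ?vcoordD ?vcoordZ ?embu ?embv.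
    by rewrite padB mulN1r.
  by rewrite mulr0 addr0.
have emb_inj : injective emb.
  move=> f f' ff'; apply/ffunP => i.
  have pe l : pad f l = pad f' l by case/mxvec_indexP: l => b j; rewrite -!embu ff'.
  have := pe (widen_ord rNk i); rewrite /pad /= (insubT (fun l => (l < r)%N) (ltn_ord i)).
  by rewrite (_ : Sub _ _ = i) //; exact: val_inj.
exists (mem (codom emb)); split.
- by apply/codomP; exists 0; have := embB 0 0; rewrite !subrr => ->.
- by move=> x y /codomP [f ->] /codomP [f' ->]; apply/codomP; exists (f - f'); rewrite embB.
- move=> x y /codomP [f ->] /codomP [f' ->]; rewrite /symplN big1 // => b _.
  by rewrite /sympl big1 // => j _; rewrite !embv mulr0 mul0r subr0.
- by rewrite (card_codom emb_inj) card_ffun card_ord.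
Qed.

(** Choose a heaviest element of the coset of [y]. The predicate [best y] depends only on this
    coset, hence so does the element picked. *)
Lemma ml_decoder {R : realType} {V : finZmodType} (A : pred V) (wt : V -> R) :
    0 \in A -> (forall x y, x \in A -> y \in A -> x - y \in A) ->
  exists dec : V -> V, [/\ forall y, y - dec y \in A,
    forall x y, x - y \in A -> dec x = dec y & forall y, wt y <= wt (dec y)].
Proof.
move=> A0 AB.
pose best y y' := (y - y' \in A) && [forall y'', (y - y'' \in A) ==> (wt y'' <= wt y')].
have ex y : exists y', best y y'.
  have yA : y - y \in A by rewrite subrr.
  case: (@arg_maxP _ _ V y (fun y' => y - y' \in A) wt yA) => y' y'A y'max.
  by exists y'; rewrite /best y'A; apply/forallP => y''; apply/implyP => /y'max.
pose dec y := odflt 0 [pick y' | best y y'].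
have decP y : best y (dec y).
  rewrite /dec; case: pickP => [//|H]; have [y'] := ex y.
  by rewrite H.
exists dec; split.
- by move=> y; case/andP: (decP y).
- move=> x y xy; rewrite /dec; congr odflt; apply: eq_pick => y' /=.
  have E z : (x - z \in A) = (y - z \in A).
    have -> : x - z = (y - z) + (x - y) by rewrite [RHS]addrC [RHS]addrA subrK.
    exact: subgroupDr.
  rewrite /best E; congr (_ && _); apply: eq_forallb => y''; by rewrite E.
- move=> y; case/andP: (decP y) => _ /forallP/(_ y).
  by rewrite subrr A0.
Qed.

Section CodeExistence.
Context {R : realType} {F : finFieldType} {N m k D : nat}.
Local Notation C := R[i].
Local Notation YN := {ffun 'I_N -> 'rV[F]_m}.
Local Notation ZN := {ffun 'I_N -> 'rV[F]_(k * 2)}.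
Local Notation V := (YN * YN * ZN)%type.
Variables (e : F -> C) (E : V -> 'M[C]_D) (c : V -> V -> C).
Hypotheses (e0 : e 0 = 1) (eD : forall a b, e (a + b) = e a * e b).
Hypothesis e_inj : forall a, a != 0 -> e a != 1.
Hypothesis D_gt0 : (0 < D)%N.
Hypothesis E0 : E 0 = 1%:M.
Hypothesis EM : forall x y, E x *m E y = c x y *: E (x + y).
Hypothesis EC : forall x y, E x *m E y = e (errform x y) *: (E y *m E x).
Hypothesis EV : forall x, adj (E x) *m E x = 1%:M.
Variables (p : V -> R) (q : YN -> ZN -> R).
Hypothesis p0 : forall v, 0 <= p v.
Hypothesis q0 : forall s u, 0 <= q s u.
Hypothesis p_sum1 : \sum_v p v = 1.
Hypothesis pq : forall f : YN -> ZN -> bool,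
  \sum_(v | f v.1.2 v.2) p v = \sum_s \sum_(u | f s u) q s u.

(** The stabilizer consists of all [w], syndrome [s = 0], and the preimage of [T] under a good
    isometry [g]. Vectors in its annihilator have [s = 0] and [g u] in [perp symplN T], which is the
    event controlled by [random_coding]. *)
Lemma random_stabilizer_code (r : nat) (rho : R) : (r <= N * k)%N -> 0 <= rho <= 1 ->
  exists (Cm : 'M[C]_D) (M : nat) (Ks : 'I_M -> 'M[C]_D),
  [/\ Kraus_TP Ks, (#|F| ^ (N * m + r) * \rank Cm)%N = D &
      forall psi : 'rV[C]_D, (psi <= Cm)%MS -> (map_mx conjc psi *m psi^T) 0 0 = 1 ->
      1 - (#|F| ^ r)%:R `^ (- rho) * gallager q rho <=
      \sum_x p x * \sum_j normsq ((adj psi^T *m (Ks j *m (E x *m psi^T))) 0 0)].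
Proof.
move=> rNk rho01.
have [T [T0 TB Tiso Tcard]] := isotropic_subgroup (F := F) N k r rNk.
have F_gt0 : (0 < #|F|)%N by apply/card_gt0P; exists 0.
have cT : (#|T| * #|perp symplN T|)%N = #|{: ZN}|.
  by apply: (card_perp e symplN e0 eD e_inj) => //;
    [exact: symplNDl|exact: symplNDr|exact: symplN_nondeg].
have T_gt0 : (0 < #|T|)%N by rewrite Tcard expn_gt0 F_gt0.
have [g gi gbound] := random_coding symplN (symplNDl _) (symplNDr _) (symplNZl _)
  (symplNZr _) (symplN_alt _) (symplN_nondeg _) T cT T_gt0 q q0.
have [gB gF] := isometryP _ _ gi.
have g_inj := isometry_inj _ (symplNDr _) (symplN_nondeg _) _ gi.
have g0 := isometry0 _ _ gi.
pose S : pred V := [pred v | (v.1.2 == 0) && (g v.2 \in T)].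
have S0 : 0 \in S by rewrite inE /= eqxx g0 T0.
have SB x y : x \in S -> y \in S -> x - y \in S.
  rewrite !inE /= => /andP[/eqP -> xT] /andP[/eqP -> yT].
  by rewrite subr0 eqxx gB TB.
have dot0 (x : YN) : dotN x 0 = 0 by rewrite dotNC dotN0l.
have Siso x y : x \in S -> y \in S -> errform x y = 0.
  rewrite !inE /= => /andP[/eqP xs xT] /andP[/eqP ys yT].
  by rewrite /errform xs ys dot0 dotN0l subr0 add0r -gF Tiso.
have perpS v : v \in perp errform S -> v.1.2 = 0 /\ g v.2 \in perp symplN T.
  move=> /perpP H; split.
    apply/eqP; apply: contraT => /dotN_nondeg [w ws].
    have : errform v ((w, 0), 0) = 0 by apply: H; rewrite inE /= eqxx g0 T0.
    rewrite /errform /= dot0 sub0r (form_x0 _ (symplNDr _)) addr0 dotNC.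
    by move/eqP; rewrite oppr_eq0 (negPf ws).
  apply/perpP => t tT; have [g' gK g'K] := injF_bij g_inj.
  have : errform v ((0, 0), g' t) = 0 by apply: H; rewrite inE /= eqxx g'K tT.
  by rewrite /errform /= !dot0 subr0 add0r -gF g'K.
(* Candidates are weighted by the law of [(s, u)]: within a coset [s] is constant and [w] is
   arbitrary. *)
have [dec [decP dec_eq dec_max]] := ml_decoder (perp errform S) (fun v => q v.1.2 v.2)
  (perp0 _ errformDl _) (perpB _ errformDl _).
have [Cm [M [Ks [TP rk fid]]]] := stabilizer_code e errform e0 eD e_inj errformDl errformDr
  errform_nondeg E c D_gt0 E0 EM EC EV S S0 SB Siso dec decP dec_eq.
exists Cm, M, Ks; split => //.
  rewrite -[RHS]rk; congr (_ * _)%N.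
  rewrite expnD -Tcard.
  have -> : (#|F| ^ (N * m))%N = #|{: YN}|.
    by rewrite card_ffun card_ord card_mx mul1n -expnM mulnC.
  have [g' gK g'K] := injF_bij g_inj.
  pose f (x : YN * ZN) : V := ((x.1, 0), g' x.2).
  have f_inj : injective f by move=> [w u] [w' u'] [-> /(can_inj g'K) ->].
  rewrite -cardX -(card_image f_inj); apply: eq_card => -[[w s] u].
  rewrite [RHS]inE /=; apply/fintype.imageP/idP.
    by move=> [[w' u'] /andP[_ u'T] [_ -> ->]]; rewrite eqxx g'K.
  by move=> /andP[/eqP -> uT]; exists (w, g u); rewrite ?inE //= /f gK.
move=> psi psiC psi1; apply: le_trans (fid p psi p0 psiC psi1).
rewrite -[X in X - _]p_sum1 (bigID (fun x => x - dec x \in S)) /= -addrA gerDl subr_le0.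
apply: (@le_trans _ _ (\sum_s \sum_(u | [exists u', [&& u' != u,
    g (u' - u) \in perp symplN T & q s u <= q s u']]) q s u)).
  rewrite -pq; rewrite [leRHS]big_mkcond [leLHS]big_mkcond.
  apply: ler_sum => x _; case: ifPn => [bad|_]; last by case: ifP.
  (* A wrong guess is itself a competitor: it shares the syndrome, differs in [u], and is at least
     as likely. *)
  rewrite ifT //; apply/existsP; exists (dec x).2.
  have [/= s0 gP] := perpS _ (decP x).
  have ss : x.1.2 = (dec x).1.2 by apply/eqP; rewrite -subr_eq0 s0.
  apply/and3P; split.
  - apply: contra bad => /eqP uu; rewrite inE /= s0 eqxx /=.
    by rewrite uu subrr g0.
  - rewrite -opprB -[- _]sub0r gB g0.
    by apply: (perpB _ (symplNDl _)) => //; exact: (perp0 _ (symplNDl _)).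
  - by have := dec_max x; rewrite -ss.
apply: (le_trans gbound); rewrite /gallager mulr_sumr; apply: ler_sum => s _.
rewrite -Tcard; apply: (gallager_bound _ (q s) #|T|%:R rho) => //.
by rewrite ltr0n.
Qed.

End CodeExistence.

(** * Highest fidelity and error exponent *)

Section HighestFidelity.
Context {R : realType} {d : nat} {omega : R[i]}.
Hypotheses (d_prime : prime d) (omega_prim : d.-primitive_root omega).
Variable P : 'F_d * 'F_d -> R.
Hypothesis P_dist : isDist P.
Local Notation C := R[i].
Local Notation code_fidelity M Cm Ks :=
  (fidelity Cm (fun rho => Kraus_map Ks (chanM d omega P M rho))).

Lemma Ppow_dist M : isDist (Ppow d M P).
Proof.
split=> [x|]; last exact: sum_Ppow.
by case: P_dist => P0 _; apply: prodr_ge0.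
Qed.

Lemma code_fidelity_ge M (Cm : 'M[C]_#|QBasis d M|) m (Ks : 'I_m -> 'M[C]_#|QBasis d M|) b :
  (0 < \rank Cm)%N ->
  (forall psi : 'rV[C]_#|QBasis d M|, (psi <= Cm)%MS ->
     (map_mx conjc psi *m psi^T) 0 0 = 1 ->
     b <= \sum_x Ppow d M P x *
       \sum_j normsq ((adj psi^T *m (Ks j *m (Ntens d omega M x *m psi^T))) 0 0)) ->
  b <= code_fidelity M Cm Ks.
Proof.
move=> rk H; apply: lb_le_inf.
  have [psi psiC psi1] := unit_vector_in _ _ rk; eexists; exists psi.
  by split=> //; reflexivity.
by move=> _ [psi [psiC psi1 ->]]; rewrite fidelity_valueE; exact: H.
Qed.

Lemma code_fidelity_le1 M (Cm : 'M[C]_#|QBasis d M|) m (Ks : 'I_m -> 'M[C]_#|QBasis d M|) :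
  (0 < \rank Cm)%N -> Kraus_TP Ks -> code_fidelity M Cm Ks <= 1.
Proof.
move=> rk TP; have [psi psiC psi1] := unit_vector_in _ _ rk.
have [Pp0 _] := Ppow_dist M.
apply: (@le_trans _ _ (\sum_x Ppow d M P x *
       \sum_j normsq ((adj psi^T *m (Ks j *m (Ntens d omega M x *m psi^T))) 0 0))).
  apply: ge_inf.
    exists 0 => _ [psi' [_ _ ->]]; rewrite fidelity_valueE.
    apply: sumr_ge0 => x _; rewrite mulr_ge0 // sumr_ge0 // => j _; exact: normsq_ge0.
  by exists psi; split=> //; rewrite fidelity_valueE.
apply: fidelity_value_le1 => //; first exact: Ppow_dist.
by move=> x; exact: NtensV.
Qed.

Lemma card_QBasis M : #|QBasis d M| = (d ^ M)%N.
Proof. by rewrite card_ffun !card_ord. Qed.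

Lemma logd_exp m : logd d ((d ^ m)%:R : R) = m%:R.
Proof.
have L0 : 0 < ln (d%:R : R) by rewrite ln_gt0 // ltr1n prime_gt1.
rewrite /logd natrX -powR_mulrn // ln_powR mulfK // gt_eqF //.
Qed.

Lemma Fstar_ge M K (Cm : 'M[C]_#|QBasis d M|) m (Ks : 'I_m -> 'M[C]_#|QBasis d M|) b :
  Kraus_TP Ks -> (0 < \rank Cm)%N -> K <= logd d (\rank Cm)%:R ->
  b <= code_fidelity M Cm Ks -> b <= Fstar d omega P M K.
Proof.
move=> TP rk Klog bF; apply: (le_trans bF); apply: ub_le_sup.
  by exists 1 => _ [Cm' [m' [Ks' [TP' [rk' _] ->]]]]; exact: code_fidelity_le1.
by exists Cm, m, Ks; split.
Qed.

(** The condition on [K] admits the whole space with trivial recovery as a code, so the supremum is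
    over a nonempty set. *)
Lemma Fstar_bounds M K : K <= M%:R -> 0 <= Fstar d omega P M K <= 1.
Proof.
move=> KM; pose Ks (j : 'I_1) : 'M[C]_#|QBasis d M| := 1%:M.
have TP : Kraus_TP Ks by rewrite /Kraus_TP big_ord1 adj1 mul1mx.
have rk : (0 < \rank (1%:M : 'M[C]_#|QBasis d M|))%N.
  by rewrite mxrank1 card_QBasis expn_gt0 prime_gt0.
have Klog : K <= logd d (\rank (1%:M : 'M[C]_#|QBasis d M|))%:R.
  by rewrite mxrank1 card_QBasis logd_exp.
apply/andP; split.
  apply: (Fstar_ge _ _ _ _ _ _ TP rk Klog); apply: code_fidelity_ge => // psi _ _.
  have [Pp0 _] := Ppow_dist M.
  apply: sumr_ge0 => x _; rewrite mulr_ge0 // sumr_ge0 // => j _; exact: normsq_ge0.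
apply: ge_sup; first by eexists; exists 1%:M, 1, Ks; split; [| |reflexivity].
by move=> _ [Cm [m [Ks' [TP' [rk' _] ->]]]]; exact: code_fidelity_le1.
Qed.

Lemma errexp_ge (Rp eps : R) M : (0 < M)%N -> Rp <= 1 -> 0 < eps ->
  1 - Fstar d omega P M (Rp * M%:R) <= eps ->
  ((- logd d eps / M%:R)%:E <= errexp d omega P Rp M)%E.
Proof.
move=> M0 Rp1 eps0 Feps.
have L0 : 0 < ln (d%:R : R) by rewrite ln_gt0 // ltr1n prime_gt1.
have /andP[_ F1] : 0 <= Fstar d omega P M (Rp * M%:R) <= 1.
  by apply: Fstar_bounds; rewrite ler_piMl.
have MV : 0 < (M%:R^-1 : R) by rewrite invr_gt0 ltr0n.
(* Perfect fidelity gives the exponent [+oo], by the convention for the logarithm of 0. *)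
rewrite /errexp /elogd; case: eqP => [_|/eqP F0].
  by rewrite /= mulyr gtr0_sg // mul1e leey.
rewrite -EFinN -EFinM lee_fin ler_pM2r // lerN2 ler_pM2r ?invr_gt0 // ler_ln ?posrE //.
by rewrite lt_neqAle eq_sym F0 subr_ge0.
Qed.

End HighestFidelity.

Section ConcatenatedCode.
Context {R : realType} {d : nat} {omega : R[i]}.
Hypotheses (d_prime : prime d) (omega_prim : d.-primitive_root omega).
Variable P : 'F_d * 'F_d -> R.
Hypothesis P_dist : isDist P.
Context {n k : nat} (Hkn : (k <= n)%N).
Variables g h : 'I_n -> 'rV['F_d]_(n * 2).
Hypothesis Hgh : forall i j : 'I_n, sympl (g i) (h j) = (i == j)%:R.
Hypothesis Hgg : forall i j : 'I_n, sympl (g i) (g j) = 0.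
Hypothesis Hhh : forall i j : 'I_n, sympl (h i) (h j) = 0.
Local Notation C := R[i].
Local Notation Gamma rho := (gallager (fun s u => PL d n k P g h (s, u)) rho).

Lemma Fstar_concatenated (N r : nat) (K rho : R) :
  (r <= N * k)%N -> K <= (N * k - r)%:R -> 0 <= rho <= 1 ->
  1 - Fstar d omega P (N * n) K <= (d ^ r)%:R `^ (- rho) * Gamma rho ^+ N.
Proof.
move=> rNk Kle rho01.
have [PL0 _] := PL_dist _ _ _ Hkn d_prime P P_dist g h Hgh Hgg Hhh.
pose perr := @physerr d n k N Hkn g h.
pose q (s : {ffun 'I_N -> 'rV['F_d]_(n - k)}) (u : {ffun 'I_N -> 'rV['F_d]_(k * 2)}) :=
  \prod_b PL d n k P g h (s b, u b).
have q0 s u : 0 <= q s u by apply: prodr_ge0.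
have perr_bij : bijective perr by exact: physerr_bij.
have p_sum1 : \sum_v Ppow d (N * n) P (perr v) = 1.
  by rewrite -(sum_Ppow (N * n) P P_dist) (reindex _ (onW_bij _ perr_bij)).
have [Pp0 _] := Ppow_dist P P_dist (N * n).
have D0 : (0 < #|QBasis d (N * n)|)%N by rewrite card_QBasis expn_gt0 prime_gt0.
have E0 : Ntens d omega (N * n) (perr 0) = 1%:M.
  have -> : perr 0 = 0 by apply: (@addrI _ (perr 0)); rewrite -physerrD !addr0.
  exact: Ntens0.
have EM x y : Ntens d omega (N * n) (perr x) *m Ntens d omega (N * n) (perr y) =
    @phase R d omega (- \sum_i (perr x i).2 * (perr y i).1) *: Ntens d omega (N * n) (perr (x + y)).
  by rewrite /perr physerrD; exact: NtensM.
have EC x y : Ntens d omega (N * n) (perr x) *m Ntens d omega (N * n) (perr y) =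
    @phase R d omega (errform x y) *: (Ntens d omega (N * n) (perr y) *m Ntens d omega (N * n) (perr x)).
  by rewrite -(physerr_form Hkn g h Hgh Hgg Hhh); exact: NtensC.
have EV x : adj (Ntens d omega (N * n) (perr x)) *m Ntens d omega (N * n) (perr x) = 1%:M.
  exact: NtensV.
have pq := sum_blocks_PL (N := N) Hkn g h Hgh Hhh P.
have [Cm [m [Ks [TP rk fid]]]] := random_stabilizer_code _ _ _ phase0
  (phaseD d_prime omega_prim) (phase_neq1 d_prime omega_prim) D0 E0 EM EC EV
  (fun v => Ppow d (N * n) P (perr v)) q (fun v => Pp0 (perr v)) q0 p_sum1 pq r rho rNk rho01.
(* The stabilizer has [d ^ (N * (n - k) + r)] elements, and its order times the code dimension is
   [d ^ (N * n)]. *)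
have rkE : \rank Cm = (d ^ (N * k - r))%N.
  apply/eqP; rewrite -(eqn_pmul2l (m := d ^ (N * (n - k) + r))) ?expn_gt0 ?prime_gt0 //.
  rewrite -[X in (X ^ _ * _)%N == _](card_Fp d_prime) rk card_QBasis -expnD; apply/eqP.
  have -> : (N * n = N * (n - k) + N * k)%N by rewrite -mulnDr subnK.
  by congr (_ ^ _)%N; lia.
rewrite lerBlDr addrC -lerBlDr; apply: (Fstar_ge d_prime omega_prim P P_dist _ _ Cm _ Ks).
- exact: TP.
- by rewrite rkE expn_gt0 prime_gt0.
- by rewrite rkE logd_exp.
apply: code_fidelity_ge; first by rewrite rkE expn_gt0 prime_gt0.
move=> psi psiC psi1.
rewrite (reindex _ (onW_bij _ perr_bij)) /=.
apply: le_trans (fid psi psiC psi1).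
by rewrite card_Fp // /q (gallager_prod _ _ (fun s u => PL d n k P g h (s, u))).
Qed.

End ConcatenatedCode.

Lemma limn_esup_ge {R : realType} (u : nat -> \bar R) (x : R) :
  (forall (m0 : nat) (e : R), 0 < e -> exists2 m, (m0 <= m)%N & ((x - e)%:E <= u m)%E) ->
  (x%:E <= limn_esup u)%E.
Proof.
move=> H; apply: le_ereal_inf_tmp => _ [A [m0 _ mA] <-].
apply/lee_addgt0Pr => e e0; have [m mm0 um] := H m0 e e0.
apply: (@le_trans _ _ (u m + e%:E)%E).
  by rewrite -leeBlDr // -EFinB.
by rewrite leeD2r //; apply: ereal_sup_ubound; exists m => //; exact: mA.
Qed.

(** Rounding up cannot pass [m], because [m] is itself an integer above [x]. *)
Lemma least_nat_ge {R : realType} (x : R) (m : nat) : 0 <= x -> x <= m%:R ->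
  exists K : nat, [/\ x <= K%:R, (K <= m)%N & K%:R <= x + 1].
Proof.
move=> x0 xm.
case: (@ex_minnP (fun K => x <= K%:R)) => [|K xK Kmin]; first by exists m.
exists K; split=> //; first exact: Kmin.
case: K xK Kmin => [|K] xK Kmin; first by rewrite addr_ge0.
rewrite -natr1 lerD2r leNgt; apply/negP => /ltW /Kmin.
by rewrite ltnn.
Qed.

Theorem theorem2 (R : realType) (d : nat) (Hd : prime d)
  (omega : R[i]) (Homega : d.-primitive_root omega)
  (P : 'F_d * 'F_d -> R) (HP : isDist P)
  (n k : nat) (Hk1 : (1 <= k)%N) (Hkn : (k <= n)%N)
  (Lm : 'M['F_d]_(n * 2)) (HLso : self_orthogonal Lm) (HLdim : \rank Lm = (n - k)%N)
  (g h : 'I_n -> 'rV['F_d]_(n * 2))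
  (Hbasis : ((@firstg _ n k g) == Lm)%MS && row_free (@firstg _ n k g))
  (Hgh : forall i j : 'I_n, sympl (g i) (h j) = (i == j)%:R)
  (Hgg : forall i j : 'I_n, sympl (g i) (g j) = 0)
  (Hhh : forall i j : 'I_n, sympl (h i) (h j) = 0)
  (Rp : R) (HRp : 0 <= Rp <= 1) :
  (Enk d k (Rp * n%:R / k%:R) (PL d n k P g h) * (n%:R^-1)%:E
     <= limn_esup (errexp d omega P Rp))%E.
Proof.
have /andP[Rp0 Rp1] := HRp.
have d1 := prime_gt1 Hd.
have n0 : (0 < n)%N by exact: leq_trans Hkn.
have nR0 : 0 < (n%:R : R) by rewrite ltr0n.
have PLd := PL_dist _ _ _ Hkn Hd P HP g h Hgh Hgg Hhh.
have := Enk_le_gallager _ PLd d k (Rp * n%:R / k%:R) d1.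
have -> : k%:R - k%:R * (Rp * n%:R / k%:R) = k%:R - Rp * n%:R :> R.
  by rewrite mulrC divfK // pnatr_eq0 -lt0n.
move=> [E0|[c0 [rho rho01 EG]]].
  (* For a nonpositive exponent it suffices that fidelities are nonnegative: the bound [eps = 1]
     holds at every positive length. *)
  apply: (@le_trans _ _ 0%E).
    by apply: mule_le0_ge0 => //; rewrite lee_fin invr_ge0.
  apply: limn_esup_ge => m0 e e0; exists m0.+1 => //.
  have /andP[F0 _] := Fstar_bounds Hd Homega P HP m0.+1 (Rp * m0.+1%:R) (ler_piMl (ler0n _ _) Rp1).
  apply: le_trans (errexp_ge Hd Homega P HP Rp 1 _ _ _ _ _) => //; last by rewrite gerBl.
  by rewrite lee_fin /logd ln1 mul0r oppr0 mul0r sub0r oppr_le0 ltW.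
set Gam := gallager _ _ in EG.
apply: (@le_trans _ _ ((rho * (k%:R - Rp * n%:R) - logd d Gam) / n%:R)%:E).
  by rewrite EFinM; apply: lee_wpmul2r => //; rewrite lee_fin invr_ge0.
have /andP[r0 r1] := rho01.
have Gam0 : 0 < Gam by rewrite /Gam gallager_tilt // tiltG_gt0.
have L0 : 0 < ln (d%:R : R) by rewrite ln_gt0 // ltr1n.
apply: limn_esup_ge => m0 e e0.
have [N1 N1e] : exists N1 : nat, e^-1 <= N1%:R.
  by exists (Num.truncn e^-1).+1; have /andP[_ /ltW] := Num.Theory.truncn_itv (ltW (divr_gt0 ltr01 e0)); rewrite mul1r.
(* [N] exceeds [m0], to reach the tail, and [e^-1], so that the slack [e * N * n] absorbs the
   rounding of the rate, whose cost is at most [rho <= 1]. *)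
pose N := (maxn m0 N1).+1.
have N0 : 0 < (N%:R : R) by rewrite ltr0n.
(* [K] is the logarithm of the code dimension, rounded up; that it fits into [N * k] comes from
   [0 <= k - Rp * n]. *)
have [K [xK KN Kx]] : exists K : nat, [/\ Rp * n%:R * N%:R <= K%:R, (K <= N * k)%N &
     K%:R <= Rp * n%:R * N%:R + 1].
  apply: least_nat_ge; first by rewrite !mulr_ge0.
  by rewrite natrM mulrC ler_wpM2l //; lra.
exists (N * n)%N.
  by rewrite (leq_trans (leq_maxl m0 N1)) // (leq_trans (leqnSn _)) // leq_pmulr.
pose r := (N * k - K)%N.
pose eps : R := (d ^ r)%:R `^ (- rho) * Gam ^+ N.
have dr0 : 0 < ((d ^ r)%:R : R) by rewrite ltr0n expn_gt0 prime_gt0.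
have eps0 : 0 < eps by rewrite mulr_gt0 ?exprn_gt0 ?powR_gt0.
apply: le_trans (errexp_ge Hd Homega P HP Rp eps _ _ Rp1 eps0 _); last first.
- apply: (Fstar_concatenated Hd Homega P HP Hkn) => //; first exact: leq_subr.
  rewrite subKn // natrM; apply: le_trans xK.
  by rewrite -mulrA [n%:R * _]mulrC.
- by rewrite muln_gt0.
rewrite lee_fin.
have -> : logd d eps = - (rho * r%:R) + N%:R * logd d Gam.
  rewrite /eps /logd lnM ?posrE ?powR_gt0 ?exprn_gt0 // ln_powR lnXn // mulrDl.
  have lr : ln (d ^ r)%:R / ln d%:R = r%:R :> R := logd_exp Hd r.
  by rewrite !mulNr -[rho * _ / _]mulrA lr -[ln Gam *+ N]mulr_natl -[N%:R * _ / _]mulrA.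
have rE : r%:R = N%:R * k%:R - K%:R :> R by rewrite natrB // natrM.
rewrite natrM ler_pdivlMr ?mulr_gt0 // rE.
have eN : 1 <= e * N%:R.
  rewrite -ler_pdivrMl // mulr1 (le_trans N1e) // ler_nat.
  by rewrite (leq_trans (leq_maxr m0 N1)).
have nge1 : 1 <= (n%:R : R) by rewrite ler1n.
have -> : ((rho * (k%:R - Rp * n%:R) - logd d Gam) / n%:R - e) * (N%:R * n%:R) =
  rho * (N%:R * k%:R - Rp * n%:R * N%:R) - N%:R * logd d Gam - (e * N%:R) * n%:R.
  by field; rewrite gt_eqF.
have : rho * K%:R <= rho * (Rp * n%:R * N%:R) + 1.
  apply: (le_trans (ler_wpM2l r0 Kx)); rewrite mulrDr lerD2l mulr1 //.
have : 1 <= e * N%:R * n%:R by apply: (le_trans eN); rewrite ler_peMr // (le_trans ler01 eN).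
move: (logd d Gam) (e * N%:R * n%:R) => lg w.
by lra.
Qed.
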